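(* Let $G$ be a finite group generated by pseudoreflections on $\mathbb{C}^n$, let $d=|G|$, let $f$ be a holomorphic function on $\mathbb{C}^n$, and let $p_1,\ldots,p_d$ be a basis of $\mathbb{C}[\boldsymbol z]$ as a $\mathbb{C}[\boldsymbol z]^G$-module. Then there exist unique $G$-invariant holomorphic functions $f_1,\ldots,f_d$ on $\mathbb{C}^n$ such that $$f=p_1f_1+\cdots+p_df_d.$$
   Context: A pseudoreflection on $\mathbb{C}^n$ is a linear map $\rho:\mathbb{C}^n\to\mathbb{C}^n$ of finite order in $GL(n,\mathbb{C})$ such that $I_n-\rho$ has rank $1$. A function $f$ on $\mathbb{C}^n$ is $G$-invariant if $f(\rho^{-1}\boldsymbol z)=f(\boldsymbol z)$ for all $\rho\in G$ and $\boldsymbol z\in\mathbb{C}^n$. $\mathbb{C}[\boldsymbol z]=\mathbb{C}[z_1,\ldots,z_n]$ and $\mathbb{C}[\boldsymbol z]^G$ is the ring of $G$-invariant polynomials. By the Chevalley-Shephard-Todd theorem, $\mathbb{C}[\boldsymbol z]$ is a free $\mathbb{C}[\boldsymbol z]^G$-module of rank $|G|$. *)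

(* Defs.v *)
From HB Require Import structures.
From mathcomp Require Import all_boot all_order all_algebra.
From mathcomp Require Import complex.
From mathcomp Require Import all_classical all_reals all_analysis.
(* The notations of mpoly clash with those of all_analysis, so they are left
   out: [mpoly n K] is the polynomial ring K[X_0, ..., X_(n-1)]. *)
From mathcomp Require Import -(notations) mpoly.

Set Implicit Arguments.
Unset Strict Implicit.
Unset Printing Implicit Defensive.

Import Order.TTheory GRing.Theory Num.Theory.
Import numFieldNormedType.Exports.

Local Open Scope classical_set_scope.
Local Open Scope ring_scope.

(* Complex Frechet differentiability at every point of C^n; [R[i]^o] is R[i]
   seen as a normed module over itself, so that the differential is C-linear. *)
Definition holomorphic (R : realType) (n : nat) (f : 'cV[R[i]]_n -> R[i]) :=
  forall z, differentiable (f : 'cV[R[i]]_n -> R[i]^o) z.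

Definition pseudoreflection (R : realType) (n : nat) (rho : 'M[R[i]]_n) :=
  (exists2 k : nat, (0 < k)%N & rho ^+ k = 1%:M) /\ \rank (1%:M - rho) = 1%N.

Definition linear_group (R : realType) (n : nat) (G : set 'M[R[i]]_n) :=
  [/\ G `<=` [set A | A \in unitmx],
      G 1%:M,
      forall A B, G A -> G B -> G (A *m B) &
      forall A, G A -> G (invmx A)].

Definition generated_by_pseudoreflections (R : realType) (n : nat)
    (G : set 'M[R[i]]_n) :=
  exists2 S : set 'M[R[i]]_n,
    S `<=` @pseudoreflection R n & G = smallest (@linear_group R n) S.

Definition invariant_fun (R : realType) (n : nat) (G : set 'M[R[i]]_n)
    (f : 'cV[R[i]]_n -> R[i]) :=
  forall (rho : 'M[R[i]]_n) (z : 'cV[R[i]]_n),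
    G rho -> f (invmx rho *m z) = f z.

Definition polyfun (R : realType) (n : nat) (p : mpoly n R[i])
    (z : 'cV[R[i]]_n) : R[i] :=
  meval (fun i => z i ord0) p.

Definition invariant_poly (R : realType) (n : nat) (G : set 'M[R[i]]_n)
    (p : mpoly n R[i]) :=
  invariant_fun G (polyfun p).

(* The family p is a basis of C[z] as a module over the G-invariants. *)
Definition basis_over_invariants (R : realType) (n d : nat)
    (G : set 'M[R[i]]_n) (p : 'I_d -> mpoly n R[i]) :=
  (forall q : mpoly n R[i], exists2 a : 'I_d -> mpoly n R[i],
     forall i, invariant_poly G (a i) & q = \sum_(i < d) p i * a i) /\
  (forall a : 'I_d -> mpoly n R[i], (forall i, invariant_poly G (a i)) ->
     \sum_(i < d) p i * a i = 0 -> forall i, a i = 0).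

(* Main.v *)
Require Import Defs.
From HB Require Import structures.
From mathcomp Require Import all_boot all_order all_algebra.
From mathcomp Require Import complex.
From mathcomp Require Import all_classical all_reals all_analysis.
From mathcomp Require Import -(notations) mpoly.
From mathcomp Require Import zify ring lra.

Import Order.TTheory GRing.Theory Num.Theory.
Import numFieldNormedType.Exports.
Import ComplexField.Normc.

Set Implicit Arguments.
Unset Strict Implicit.
Unset Printing Implicit Defensive.

Local Open Scope classical_set_scope.
Local Open Scope ring_scope.
Local Open Scope complex_scope.


(** Why the theorem holds.  Let [s i] enumerate the [d] elements of [G].  If
    [f = \sum_j p j * g j] with invariant [g j], then moving this identity along
    the orbit of [z] gives a linear system for the values [g j z], with matrix
    [M z i j = p j ((s i)^-1 z)].  Its determinant [D] does not vanish at a point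
    whose orbit has [d] elements: a relation between the rows of [M z], applied to
    the coordinates of a polynomial in the basis [p], becomes a relation between
    the values of that polynomial on the orbit, and these values are arbitrary
    ([system_det_neq0]).  Uniqueness follows, since the [g j] are determined where
    [D] does not vanish, which is a dense set ([coordinates_uniq]).

    For existence, [f] is a locally uniform limit of polynomials [F k]
    ([polynomial_approximation]); let [a k j] be the coordinates of [F k] in the
    basis.  By Cramer's rule [D * a k j] is, locally uniformly, a Cauchy sequence.
    The determinant can be divided out: [malgrange] bounds a polynomial [h] at [z]
    by the values of [D * h] on a circle around [z], in a complex line through a
    fixed point where [D] does not vanish.  It is a one-variable inequality: on
    the unit circle the roots of [D] inside the disc may be reflected to the
    outside without changing its modulus, and then the mean value property of
    polynomials applies.  So the [a k j] converge locally uniformly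
    ([coordinates_bound]), a locally uniform limit of polynomials is holomorphic
    ([holomorphic_limit]), and the limits are the required [g j].

    The function theory that this takes is developed without integrals.  Means
    over the roots of unity of order [2 ^ m] replace integrals over circles: for
    polynomials of low degree they extract coefficients exactly
    ([sum_nodes_coef]), which is Cauchy's formula.  For an entire function of one
    variable, which is only assumed to be differentiable, trapezoidal sums along
    the boundaries of the images of dyadic squares are additive under bisection
    and vanish exactly on affine functions, so that Goursat's argument shows that
    they tend to [0] ([circulation_to0]).  Applied to a difference quotient of
    [f] on a contraction of the circle, this says that the interpolants of [f] at
    the roots of unity converge to [f] inside the disc ([interpolant_cvg]); with
    Cauchy's estimates the convergence becomes uniform in terms of a bound of [f]
    on a larger circle ([interpolant_error]).  Interpolating in one coordinate
    after the other yields the approximation in several variables. *)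

(** * The modulus as a real number *)

Section Modulus.
Context {R : realType}.
Implicit Types x y : R[i].

Lemma normCE x : `|x| = (normc x)%:C.
Proof. by []. Qed.

Lemma normc_ge0 x : 0 <= normc x.
Proof. by rewrite -lecR -normCE normr_ge0. Qed.

Lemma normc_eq0 x : (normc x == 0) = (x == 0).
Proof. by apply/eqP/eqP => [/eq0_normc//|->]; rewrite normc0. Qed.

Lemma normc_gt0 x : (0 < normc x) = (x != 0).
Proof. by rewrite lt_def normc_ge0 andbT normc_eq0. Qed.

Lemma normcBC x y : normc (x - y) = normc (y - x).
Proof. by rewrite -normcN opprB. Qed.

Lemma normcX x k : normc (x ^+ k) = normc x ^+ k.
Proof. by elim: k => [|k IH]; rewrite ?expr0 ?normc1 // !exprS normcM IH. Qed.

Lemma normcR (r : R) : normc r%:C = `|r|.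
Proof. by rewrite /= expr0n addr0 sqrtr_sqr. Qed.

Lemma normc_natr k : normc (k%:R : R[i]) = k%:R.
Proof. by rewrite -(rmorph_nat (real_complex R)) normcR ger0_norm. Qed.

Lemma le_normc_sum (I : Type) (s : seq I) (P : pred I) (F : I -> R[i]) :
  normc (\sum_(i <- s | P i) F i) <= \sum_(i <- s | P i) normc (F i).
Proof.
elim/big_rec2: _ => [|i y1 y2 _ IH]; first by rewrite normc0.
by apply: le_trans (le_normcD _ _) _; rewrite lerD2l.
Qed.

Lemma normc_prod (I : Type) (s : seq I) (P : pred I) (F : I -> R[i]) :
  normc (\prod_(i <- s | P i) F i) = \prod_(i <- s | P i) normc (F i).
Proof.
by elim/big_rec2: _ => [|i y1 y2 _ IH]; rewrite ?normc1 // normcM IH.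
Qed.

Lemma le_normcB x y : normc x - normc y <= normc (x - y).
Proof. by rewrite lerBlDr -{1}(subrK y x); exact: le_normcD. Qed.

Lemma normc_le_ReIm x : normc x <= `|complex.Re x| + `|complex.Im x|.
Proof.
case: x => a b /=; rewrite -[leRHS]ger0_norm ?addr_ge0// -sqrtr_sqr.
apply: ler_wsqrtr; rewrite sqrrD !real_normK ?num_real//.
by rewrite [leRHS]addrAC lerDl mulrn_wge0 ?mulr_ge0.
Qed.

Lemma Re_le_normc x : `|complex.Re x| <= normc x.
Proof.
case: x => a b /=; rewrite -sqrtr_sqr; apply: ler_wsqrtr.
by rewrite lerDl sqr_ge0.
Qed.

Lemma Im_le_normc x : `|complex.Im x| <= normc x.
Proof.
case: x => a b /=; rewrite -sqrtr_sqr; apply: ler_wsqrtr.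
by rewrite lerDr sqr_ge0.
Qed.

End Modulus.

(** * Roots of unity on the circle *)

Section Circle.
Context {R : realType}.
Implicit Types s t : R.

(** The parameter counts full turns, so that dyadic [t] give exactly the
    roots of unity of order a power of two. *)
Definition cis t : R[i] := cos (pi *+ 2 * t) +i* sin (pi *+ 2 * t).

Lemma cisD s t : cis (s + t) = cis s * cis t.
Proof.
apply/eqP; rewrite /cis mulrDr cosD sinD eq_complex/=.
by rewrite eqxx addrC [X in X + _]mulrC [X in _ + X]mulrC addrC eqxx.
Qed.

Lemma cis0 : cis 0 = 1.
Proof. by rewrite /cis mulr0 cos0 sin0. Qed.

Lemma cis1 : cis 1 = 1.
Proof. by rewrite /cis mulr1 cos2pi -[pi *+ 2]add0r sinD2pi sin0. Qed.

Lemma cis_quarter_sqr : cis 4^-1 ^+ 2 = -1.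
Proof.
rewrite /cis (_ : pi *+ 2 * 4^-1 = pi / 2 :> R); last by field.
rewrite cos_pihalf sin_pihalf; exact: sqr_i.
Qed.

Lemma normc_cis t : normc (cis t) = 1.
Proof. by rewrite /= cos2Dsin2 sqrtr1. Qed.

Lemma cisX t k : cis t ^+ k = cis (t *+ k).
Proof.
by elim: k => [|k IH]; rewrite ?expr0 ?cis0// exprS IH mulrS cisD.
Qed.

Lemma lipschitz_of_derive (f df : R -> R) :
  (forall x : R, is_derive x 1 f (df x)) -> (forall x, `|df x| <= 1) ->
  forall x y, `|f x - f y| <= `|x - y|.
Proof.
move=> fd dfb.
suff H x y : x <= y -> `|f y - f x| <= `|y - x|.
  move=> x y; case: (leP x y) => [/H|/ltW/H//].
  by rewrite distrC (distrC y).
move=> xy; have [c _ ->] : exists2 c, c \in `[x, y]%R & f y - f x = df c * (y - x).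
  apply: MVT_segment => //.
  apply: continuous_subspaceT => z.
  by apply: differentiable_continuous; apply/derivable1_diffP; case: (fd z).
by rewrite normrM ler_piMl.
Qed.

Lemma cis_lipschitz s t : normc (cis s - cis t) <= 16 * `|s - t|.
Proof.
have pi4 : pi *+ 2 <= 8 :> R.
  by have [/andP[_ h] _] := @pihalf_02_cos_pihalf R; rewrite mulr2n; lra.
have pi0 : 0 <= pi *+ 2 :> R by rewrite mulrn_wge0 ?pi_ge0.
apply: le_trans (normc_le_ReIm _) _ => /=.
have Hc := @lipschitz_of_derive cos (fun x => - sin x) _ _
  (pi *+ 2 * s) (pi *+ 2 * t).
have Hs := @lipschitz_of_derive sin cos _ _ (pi *+ 2 * s) (pi *+ 2 * t).
have e : `|pi *+ 2 * s - pi *+ 2 * t| <= 8 * `|s - t|.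
  by rewrite -mulrBr normrM (ger0_norm pi0) ler_wpM2r.
have c1 (x : R) : `|- sin x| <= 1 by rewrite normrN ler_norml sin_geN1 sin_le1.
have s1 (x : R) : `|cos x| <= 1 by rewrite ler_norml cos_geN1 cos_le1.
have := Hc (fun x => is_derive_cos x) c1; have := Hs (fun x => is_derive_sin x) s1.
by lra.
Qed.

End Circle.

(** * Goursat's lemma for trapezoidal sums *)

Section Goursat.
Context {R : realType}.
Implicit Types (f F : R[i] -> R[i]) (g : R -> R -> R[i]) (P : R -> R[i]).

(** Complex differentiability at [z], with moduli and tolerances in [R] so that
    the estimates can be carried out in an ordered field. *)
Definition cdiff f (z : R[i]) := exists a : R[i], forall e : R, 0 < e ->
  exists2 dl : R, 0 < dl & forall w, normc (w - z) <= dl ->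
    normc (f w - f z - a * (w - z)) <= e * normc (w - z).

(** The trapezoidal approximation of the integral of [F] along a segment. *)
Definition chord F (a b : R[i]) : R[i] := (F a + F b) / 2 * (b - a).

Definition pathsum F m P : R[i] :=
  \sum_(0 <= j < 2 ^ m) chord F (P (j%:R / 2 ^+ m)) (P (j.+1%:R / 2 ^+ m)).

Lemma eq_pathsum F m P Q : P =1 Q -> pathsum F m P = pathsum F m Q.
Proof. by move=> PQ; apply: eq_bigr => j _; rewrite !PQ. Qed.

Lemma pathsum_halve F m P (x : R) k :
  pathsum F m.+1 (fun s => P (x + s / 2 ^+ k)) =
  pathsum F m (fun s => P (x + s / 2 ^+ k.+1)) +
  pathsum F m (fun s => P (x + 2 ^- k.+1 + s / 2 ^+ k.+1)).
Proof.
have p0 : (2 ^+ m : R) != 0 by rewrite expf_neq0.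
have q0 : (2 ^+ k : R) != 0 by rewrite expf_neq0.
rewrite /pathsum (big_cat_nat (n := 2 ^ m)) //=; last by rewrite leq_exp2l.
have := big_addn 0 (2 ^ m.+1) (2 ^ m) xpredT (fun j => chord F
  (P (x + j%:R / 2 ^+ m.+1 / 2 ^+ k)) (P (x + j.+1%:R / 2 ^+ m.+1 / 2 ^+ k))).
rewrite add0n (_ : (2 ^ m.+1 - 2 ^ m = 2 ^ m)%N) => [->|].
congr (_ + _); apply: eq_bigr => j _; congr (chord F (P _) (P _)).
- by rewrite !exprS; field; rewrite p0 q0.
- by rewrite !exprS; field; rewrite p0 q0.
- by rewrite natrD natrX !exprS; field; rewrite p0 q0.
- by rewrite -addSn natrD natrX !exprS; field; rewrite p0 q0.
by rewrite expnS mul2n -addnn addnK.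
Qed.

Definition circulation F m g : R[i] :=
  pathsum F m (g^~ 0) + pathsum F m (g 1) -
  pathsum F m (g^~ 1) - pathsum F m (g 0).

(** The restriction of [g] to the square of side [2 ^- k] with corner [(x, y)],
    parametrized again by the unit square, so that bisection can be iterated. *)
Definition subsquare (x y : R) (k : nat) g : R -> R -> R[i] :=
  fun s t => g (x + s / 2 ^+ k) (y + t / 2 ^+ k).

Lemma circulation_split F m g (x y : R) k (h := 2 ^- k.+1) :
  circulation F m.+1 (subsquare x y k g) =
    circulation F m (subsquare x y k.+1 g) +
    circulation F m (subsquare (x + h) y k.+1 g) +
    (circulation F m (subsquare x (y + h) k.+1 g) +
     circulation F m (subsquare (x + h) (y + h) k.+1 g)).
Proof.
have q0 : (2 ^+ k : R) != 0 by rewrite expf_neq0.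
have E0 (u : R) i : u + 0 / 2 ^+ i = u by rewrite mul0r addr0.
have E1 (u : R) : u + h + 1 / 2 ^+ k.+1 = u + 1 / 2 ^+ k.
  by rewrite /h exprS; field.
rewrite /circulation /subsquare !E0 !E1 /= -/h.
rewrite !(pathsum_halve _ _ (g^~ _)) !(pathsum_halve _ _ (g _)) -/h !div1r -/h.
ring.
Qed.

Definition lipschitz_path (l : R) P := forall s s' : R,
  0 <= s <= 1 -> 0 <= s' <= 1 -> normc (P s - P s') <= l * `|s - s'|.

Lemma dyadic_itv m j : (j <= 2 ^ m)%N -> 0 <= (j%:R / 2 ^+ m : R) <= 1.
Proof.
move=> jm; rewrite divr_ge0 ?ler0n ?exprn_ge0//=.
by rewrite ler_pdivrMr ?exprn_gt0// mul1r -natrX ler_nat.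
Qed.

(** Chords integrate affine functions exactly, so only the deviation of [F]
    from an affine function is felt. *)
Lemma pathsum_near_affine F m P (c0 c1 : R[i]) (eta l : R) :
  0 <= l -> lipschitz_path l P ->
  (forall s, 0 <= s <= 1 -> normc (F (P s) - (c0 + c1 * P s)) <= eta) ->
  normc (pathsum F m P - (c0 * P 1 + c1 * P 1 ^+ 2 / 2
                          - (c0 * P 0 + c1 * P 0 ^+ 2 / 2))) <= eta * l.
Proof.
move=> l0 Pl FP; pose Q j := c0 * P (j%:R / 2 ^+ m) + c1 * P (j%:R / 2 ^+ m) ^+ 2 / 2.
have p0 : (2 ^+ m : R) != 0 by rewrite expf_neq0.
have p1 : (0 : R) < 2 ^+ m by rewrite exprn_gt0.
have -> : c0 * P 1 + c1 * P 1 ^+ 2 / 2 - (c0 * P 0 + c1 * P 0 ^+ 2 / 2) =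
    \sum_(0 <= j < 2 ^ m) (Q j.+1 - Q j).
  by rewrite telescope_sumr// /Q mul0r natrX divff.
rewrite /pathsum -sumrB.
apply: le_trans (le_normc_sum _ _ _) _.
have -> : eta * l = \sum_(0 <= j < 2 ^ m) eta * l / 2 ^+ m.
  rewrite sumr_const_nat subn0 -[RHS]mulr_natr natrX.
  by rewrite divfK.
rewrite big_nat [leRHS]big_nat; apply: ler_sum => j /andP[_ jm].
have [i0 i1] := (dyadic_itv (ltnW jm), dyadic_itv jm).
set a := P (j%:R / _); set b := P (j.+1%:R / _).
have -> : chord F a b - (Q j.+1 - Q j) =
    ((F a - (c0 + c1 * a)) / 2 + (F b - (c0 + c1 * b)) / 2) * (b - a).
  by rewrite /chord /Q -/a -/b; field.
rewrite normcM -mulrA; apply: ler_pM; rewrite ?normc_ge0//.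
  apply: le_trans (le_normcD _ _) _.
  rewrite !normcM normcV normc_natr.
  by have := FP _ i0; have := FP _ i1; rewrite -/a -/b; lra.
apply: le_trans (Pl _ _ i1 i0) _.
rewrite ler_wpM2l// -mulrBl -natrB// subSnn mul1r ger0_norm// invr_ge0 ltW//.
Qed.

Definition lipschitz_square (L : R) g := forall s s' t t' : R,
  0 <= s <= 1 -> 0 <= s' <= 1 -> 0 <= t <= 1 -> 0 <= t' <= 1 ->
  normc (g s t - g s' t') <= L * (`|s - s'| + `|t - t'|).

Lemma circulation_near_affine F m g (c0 c1 : R[i]) (eta l : R) :
  0 <= l -> lipschitz_square l g ->
  (forall s t, 0 <= s <= 1 -> 0 <= t <= 1 ->
     normc (F (g s t) - (c0 + c1 * g s t)) <= eta) ->
  normc (circulation F m g) <= 4 * (eta * l).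
Proof.
move=> l0 gl Fg.
have i0 : 0 <= (0 : R) <= 1 by rewrite lexx ler01.
have i1 : 0 <= (1 : R) <= 1 by rewrite lexx ler01.
have lh t : 0 <= t <= 1 -> lipschitz_path l (g^~ t).
  move=> ti s s' si s'i; apply: le_trans (gl _ _ _ _ si s'i ti ti) _.
  by rewrite subrr normr0 addr0.
have lv s : 0 <= s <= 1 -> lipschitz_path l (g s).
  move=> si t t' ti t'i; apply: le_trans (gl _ _ _ _ si si ti t'i) _.
  by rewrite subrr normr0 add0r.
have h0 := @pathsum_near_affine F m _ c0 c1 eta l l0 (lh _ i0)
             (fun s si => Fg _ _ si i0).
have h1 := @pathsum_near_affine F m _ c0 c1 eta l l0 (lh _ i1)
             (fun s si => Fg _ _ si i1).
have v0 := @pathsum_near_affine F m _ c0 c1 eta l l0 (lv _ i0)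
             (fun s si => Fg _ _ i0 si).
have v1 := @pathsum_near_affine F m _ c0 c1 eta l l0 (lv _ i1)
             (fun s si => Fg _ _ i1 si).
move: h0 h1 v0 v1; rewrite /circulation /=.
set A := pathsum F m (g^~ 0); set B := pathsum F m (g 1).
set C := pathsum F m (g^~ 1); set D := pathsum F m (g 0).
set qa := A - _; set qc := C - _; set qd := D - _; set qb := B - _.
have -> : A + B - C - D = (qa + qb) + ((- qc) + (- qd)).
  by rewrite /qa /qb /qc /qd; ring.
move=> h0 h1 v0 v1.
apply: le_trans (le_normcD _ _) _.
have := le_normcD qa qb; have := le_normcD (- qc) (- qd).
rewrite !normcN; lra.
Qed.

Lemma pow2_large (x : R) : exists k : nat, x <= 2 ^+ k.
Proof.
exists (Num.bound x).
have [x0|x0] := leP 0 x; last by rewrite (le_trans (ltW x0))// exprn_ge0.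
apply: le_trans (ltW (archi_boundP x0)) _.
by rewrite -natrX ler_nat ltnW// ltn_expl.
Qed.

(** Bisection: a square whose circulation does not eventually stay below [e] has
    a quarter whose circulation does not eventually stay below [e / 4].  The
    nested squares obtained in this way shrink to a point at which [F] is
    differentiable, and this is absurd since on a small square of side [h] the
    circulation is [o(h ^ 2)]. *)
Lemma circulation_to0 F g (L : R) : 0 <= L -> lipschitz_square L g ->
  (forall s t, 0 <= s <= 1 -> 0 <= t <= 1 -> cdiff F (g s t)) ->
  forall e : R, 0 < e -> exists m0, forall m, (m0 <= m)%N ->
    normc (circulation F m g) <= e.
Proof.
move=> L0 gL Fg e e0; apply: contrapT => nG.
pose small (p : R * R) k (c : R) := exists m0, forall m, (m0 <= m)%N ->
  normc (circulation F m (subsquare p.1 p.2 k g)) <= c.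

have merge x y k c (h := 2 ^- k.+1) :
    small (x, y) k.+1 c -> small (x + h, y) k.+1 c ->
    small (x, y + h) k.+1 c -> small (x + h, y + h) k.+1 c ->
    small (x, y) k (4 * c).
  move=> [m1 H1] [m2 H2] [m3 H3] [m4 H4].
  exists (m1 + m2 + m3 + m4).+1 => -[//|m] mm; rewrite circulation_split.
  have {}H1 := H1 m ltac:(lia); have {}H2 := H2 m ltac:(lia).
  have {}H3 := H3 m ltac:(lia); have {}H4 := H4 m ltac:(lia).
  apply: le_trans (le_normcD _ _) _.
  apply: le_trans (lerD (le_normcD _ _) (le_normcD _ _)) _.
  by move: H1 H2 H3 H4; rewrite /= -/h; lra.
have step : forall pk : (R * R) * nat, exists q : bool * bool,
    ~ small pk.1 pk.2 (e / 4 ^+ pk.2) ->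
    ~ small (pk.1.1 + q.1%:R * 2 ^- pk.2.+1, pk.1.2 + q.2%:R * 2 ^- pk.2.+1)
        pk.2.+1 (e / 4 ^+ pk.2.+1).
  move=> [[x y] k] /=; set h := 2 ^- k.+1; set c := e / 4 ^+ k.+1.
  have -> : e / 4 ^+ k = 4 * c.
    by rewrite /c exprS; field; rewrite expf_neq0.
  have [s1|] := pselect (small (x, y) k.+1 c); last first.
    by exists (false, false) => /=; rewrite !mul0r !addr0.
  have [s2|] := pselect (small (x + h, y) k.+1 c); last first.
    by exists (true, false) => /=; rewrite mul1r mul0r !addr0.
  have [s3|] := pselect (small (x, y + h) k.+1 c); last first.
    by exists (false, true) => /=; rewrite mul1r mul0r !addr0.
  have [s4|] := pselect (small (x + h, y + h) k.+1 c); last first.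
    by exists (true, true) => /=; rewrite !mul1r.
  by exists (true, true) => /=; case; exact: merge.
have [q qP] := choice step.
pose fix u k : R * R := if k is k'.+1 then
   let p := u k' in (p.1 + (q (p, k')).1%:R * 2 ^- k'.+1,
                     p.2 + (q (p, k')).2%:R * 2 ^- k'.+1) else (0, 0).
have uP k : ~ small (u k) k (e / 4 ^+ k).
  elim: k => [|k IH]; last exact: (qP (u k, k)).
  rewrite expr0 divr1 /small /=; apply: contra_not nG => -[m0 H]; exists m0 => m /H.
  rewrite (_ : subsquare 0 0 0 g = g)//; apply/funext => s; apply/funext => t.
  by rewrite /subsquare expr0 !divr1 !add0r.
have limit (v : nat -> R) (b : nat -> bool) : v 0%N = 0 ->
    (forall k, v k.+1 = v k + (b k)%:R * 2 ^- k.+1) ->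
    exists2 X : R, 0 <= X <= 1 &
      forall k, [/\ 0 <= v k, v k + 2 ^- k <= 1, v k <= X & X <= v k + 2 ^- k].
  move=> v0 vS.
  have hp k : (0 : R) < 2 ^- k by rewrite invr_gt0 exprn_gt0.
  have h2 k : (2 ^- k : R) = 2 ^- k.+1 + 2 ^- k.+1.
    by rewrite exprS; field; rewrite expf_neq0.
  have inc k l : v k <= v (k + l)%N.
    elim: l => [|l IH]; rewrite ?addn0// addnS vS (le_trans IH)// lerDl.
    by rewrite mulr_ge0// ltW.
  have dec k l : v (k + l)%N + 2 ^- (k + l) <= v k + 2 ^- k.
    elim: l => [|l IH]; rewrite ?addn0// addnS vS; apply: le_trans _ IH.
    rewrite -addrA lerD2l (h2 (k + l)%N) lerD2r.
    by case: (b _); rewrite ?mul1r ?mul0r// ltW.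
  have cross k l : v k <= v l + 2 ^- l.
    apply: le_trans (inc k l) _; rewrite addnC.
    by apply: le_trans (dec l k); rewrite lerDl ltW.
  have ne : has_sup (range v).
    by split; [exists (v 0%N), 0%N|exists (v 0%N + 2 ^- 0) => _ [k _ <-]].
  have lb k : v k <= sup (range v).
    by apply: ub_le_sup; [exact: ne.2|exists k].
  have ub k : sup (range v) <= v k + 2 ^- k.
    by apply: ge_sup; [exists (v 0%N), 0%N|move=> _ [l _ <-]].
  exists (sup (range v)) => [|k]; last first.
    have := inc 0%N k; have := dec 0%N k; rewrite !add0n v0 expr0 invr1 add0r.
    by split.
  by have := lb 0%N; have := ub 0%N; rewrite v0 expr0 invr1 add0r => -> ->.
have [X X01 Xu] := limit (fun k => (u k).1) (fun k => (q (u k, k)).1)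
  erefl (fun k => erefl).
have [Y Y01 Yu] := limit (fun k => (u k).2) (fun k => (q (u k, k)).2)
  erefl (fun k => erefl).
have [a Fa] := Fg X Y X01 Y01.
(* on a square of side [h] the circulation is at most [8 * e' * (L * h) ^+ 2] *)
pose e' := e / (8 * (L ^+ 2 + 1)).
have L2 : 0 < 8 * (L ^+ 2 + 1) by rewrite mulr_gt0// ltr_wpDl ?sqr_ge0.
have e'0 : 0 < e' by rewrite divr_gt0.
have [dl dl0 Fdl] := Fa e' e'0.
have [k kP] := pow2_large (2 * L / dl).
have hp : (0 : R) < 2 ^- k by rewrite invr_gt0 exprn_gt0.
have hk : 2 * L * 2 ^- k <= dl.
  by rewrite ler_pdivrMr ?exprn_gt0// -ler_pdivrMl// mulrC.
apply: (uP k); exists 0%N => m _.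
set h := 2 ^- k in hp hk *.
have mem (v Z s : R) : v <= Z -> Z <= v + h -> 0 <= s <= 1 ->
     `|v + s * h - Z| <= h.
  move=> vZ Zv /andP[s0 s1]; rewrite ler_norml.
  have : 0 <= s * h by rewrite mulr_ge0// ltW.
  have : s * h <= h by rewrite ler_piMl// ltW.
  by move: vZ Zv; lra.
have itv (v s : R) : 0 <= v -> v + h <= 1 -> 0 <= s <= 1 ->
     0 <= v + s * h <= 1.
  move=> v0 v1 /andP[s0 s1].
  have : 0 <= s * h by rewrite mulr_ge0// ltW.
  have : s * h <= h by rewrite ler_piMl// ltW.
  by move: v0 v1; lra.
have [x0 x1 xX Xx] := Xu k; have [y0 y1 yY Yy] := Yu k.
apply: le_trans (_ : 4 * (e' * (2 * L * h) * (L * h)) <= _).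
  apply: (@circulation_near_affine F m _ (F (g X Y) - a * g X Y) a).
  - by rewrite mulr_ge0// ltW.
  - move=> s s' t t' si s'i ti t'i; rewrite /subsquare -/h.
    apply: le_trans (gL _ _ _ _ _ _ _ _) _; rewrite ?itv//.
    have E (v y z : R) : v + y - (v + z) = y - z by ring.
    rewrite -mulrA ler_wpM2l// !E -!mulrBl !normrM (ger0_norm (ltW hp)).
    by rewrite -mulrDl mulrC.
  move=> s t si ti; rewrite /subsquare -/h; set w := g _ _.
  have wp : normc (w - g X Y) <= 2 * L * h.
    apply: le_trans (gL _ _ _ _ _ _ _ _) _; rewrite ?itv//.
    have := mem _ _ _ xX Xx si; have := mem _ _ _ yY Yy ti.
    by rewrite (mulrC 2) -mulrA => A B; rewrite ler_wpM2l//; lra.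
  rewrite (_ : F w - _ = F w - F (g X Y) - a * (w - g X Y)); last by ring.
  apply: le_trans (Fdl _ (le_trans wp hk)) _.
  by rewrite ler_wpM2l// ltW.
have -> : e / 4 ^+ k = e * h ^+ 2.
  rewrite /h exprVn -exprM mulnC exprM (_ : 2 ^+ 2 = 4 :> R)//.
  by rewrite -natrX.
have -> : 4 * (e' * (2 * L * h) * (L * h)) = e * h ^+ 2 * (L ^+ 2 / (L ^+ 2 + 1)).
  by rewrite /e'; field; rewrite gt_eqF// ltr_wpDl ?sqr_ge0.
apply: ler_piMr; first by rewrite mulr_ge0 ?sqr_ge0// ltW.
by rewrite ler_pdivrMr ?ltr_wpDl ?sqr_ge0// mul1r lerDl.
Qed.
End Goursat.

(** * Interpolation at roots of unity *)

Section Nodes.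
Context {R : realType}.
Implicit Types (f : R[i] -> R[i]) (m j k : nat) (r : R).

(** The order divides [2 ^ m], and it is not smaller because the power of
    exponent [2 ^ m.-1] is [cis 2^-1 = -1]. *)
Lemma cis_primitive m : (2 ^ m).-primitive_root (cis (2 ^- m : R)).
Proof.
have p0 i : (2 ^+ i : R) != 0 by rewrite expf_neq0.
have full i : cis (2 ^- i : R) ^+ (2 ^ i) = 1.
  by rewrite cisX -[_ *+ (2 ^ i)]mulr_natr natrX mulVf ?cis1.
have N0 : (0 < 2 ^ m)%N by rewrite expn_gt0.
have [d dprim ddvd] := prim_order_exists N0 (full m).
have /(dvdn_pfactor _ _ (isT : prime 2))[e em de] := ddvd.
move: em; rewrite leq_eqVlt => /orP[/eqP em|em]; first by move: dprim; rewrite de em.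
case: m em dprim {N0 ddvd} => // m em dprim.
have : cis (2 ^- m.+1 : R) ^+ (2 ^ m) = 1.
  by apply/eqP; rewrite -(prim_order_dvd dprim) de dvdn_exp2l.
rewrite cisX -[_ *+ (2 ^ m)]mulr_natr natrX exprS.
rewrite (_ : _^-1 * _ = 4^-1 + 4^-1); last by field.
rewrite cisD -expr2 cis_quarter_sqr => /eqP.
by rewrite eq_sym -addr_eq0 -mulr2n pnatr_eq0.
Qed.

Lemma sum_roots_of_unity (K : fieldType) n (w : K) k l :
  n.-primitive_root w -> (k < n)%N -> (l < n)%N ->
  \sum_(0 <= j < n) (w ^+ j) ^+ k / (w ^+ j) ^+ l = (n * (k == l))%:R.
Proof.
move=> wn kn ln.
have w0 : w != 0.
  by apply: contra_eqT (prim_expr_order wn) => /negbNE/eqP->; rewrite expr0n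
    gtn_eqF ?(prim_order_gt0 wn)// eq_sym oner_neq0.
pose x := w ^+ k / w ^+ l.
rewrite (eq_bigr (fun j => x ^+ j)); last first.
  move=> j _; rewrite /x expr_div_n -!exprM !(mulnC j).
  by rewrite !exprM.
have [kl|kl] := eqVneq k l.
  rewrite /x kl divff ?expf_neq0//.
  by rewrite (eq_bigr (fun _ => 1)) => [|j _]; rewrite ?expr1n//
    sumr_const_nat subn0 muln1.
rewrite muln0; apply/eqP; have /eqP := subrX1 x n.
rewrite {1}/x expr_div_n -!exprM !(mulnC _ n) !exprM (prim_expr_order wn).
rewrite !expr1n divr1 subrr eq_sym mulf_eq0 big_mkord => /orP[|//].
rewrite subr_eq0 /x => /eqP xe.
have : w ^+ k = w ^+ l by rewrite -[LHS](divfK (expf_neq0 l w0)) xe mul1r.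
move/eqP; rewrite (eq_prim_root_expr wn) !modn_small// => /eqP kl'.
by rewrite kl' eqxx in kl.
Qed.

Definition node m r j : R[i] := r%:C * cis (j%:R / 2 ^+ m).

Lemma nodeE m r j : node m r j = r%:C * cis (2 ^- m) ^+ j.
Proof. by rewrite /node cisX -[2 ^- m *+ j]mulr_natl. Qed.

Lemma normc_node m r j : 0 <= r -> normc (node m r j) = r.
Proof. by move=> r0; rewrite normcM normc_cis normcR mulr1 ger0_norm. Qed.

(** The mean of [q (x) / x ^ k] over the nodes [x] extracts the coefficient of
    index [k]: a Cauchy formula without integrals. *)
Lemma sum_nodes_coef m r (q : {poly R[i]}) k : 0 < r ->
  (size q <= 2 ^ m)%N -> (k < 2 ^ m)%N ->
  \sum_(0 <= j < 2 ^ m) q.[node m r j] / node m r j ^+ k = 2 ^+ m * q`_k.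
Proof.
move=> r0 sq km.
have rC : (r%:C : R[i]) != 0 by rewrite -normc_eq0 normcR normr_eq0 gt_eqF.
under eq_bigr => j _ do rewrite (horner_coef_wide _ sq) mulr_suml.
rewrite exchange_big /=.
rewrite (eq_bigr (fun i : 'I_(2 ^ m) =>
   q`_i * r%:C ^+ i / r%:C ^+ k * (2 ^ m * (i == k :> nat))%:R)); last first.
  move=> i _; rewrite -(sum_roots_of_unity (cis_primitive m) (ltn_ord i) km).
  rewrite mulr_sumr; apply: eq_bigr => j _; rewrite nodeE.
  rewrite 2!(@exprMn _ _ (r%:C)) invfM; ring.
rewrite (bigD1 (Ordinal km)) //= big1 => [|i]; last first.
  by rewrite -val_eqE /= => /negbTE->; rewrite muln0 mulr0.
by rewrite eqxx muln1 natrX addr0 mulfK ?expf_neq0// mulrC.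
Qed.

(** Cauchy's estimate, read off the mean over enough nodes. *)
Lemma coef_bound (q : {poly R[i]}) r (S : R) k : 0 < r ->
  (forall t, normc t = r -> normc q.[t] <= S) -> normc q`_k <= S / r ^+ k.
Proof.
move=> r0 qS.
pose m := maxn (size q) k.
have lt2 i : (i <= m)%N -> (i < 2 ^ m)%N.
  by move=> im; apply: leq_ltn_trans im _; rewrite ltn_expl.
have := sum_nodes_coef r0 (ltnW (lt2 _ (leq_maxl _ _))) (lt2 _ (leq_maxr _ _)).
move=> H; have p0 : (0 : R) < 2 ^+ m by rewrite exprn_gt0.
rewrite -(ler_pM2l p0).
have -> : 2 ^+ m * normc q`_k = normc (2 ^+ m * q`_k).
  by rewrite normcM normcX normc_natr.
rewrite -H; apply: le_trans (le_normc_sum _ _ _) _.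
apply: le_trans (ler_sum_nat (F := fun j => _) (G := fun j => S / r ^+ k) _) _.
  move=> j _; rewrite normcM normcV normcX (normc_node _ _ (ltW r0)).
  by rewrite ler_wpM2r ?invr_ge0 ?exprn_ge0 ?(ltW r0)// qS// normc_node// ltW.
by rewrite sumr_const_nat subn0 -[leLHS]mulr_natl natrX.
Qed.

Definition interpolant m r f : {poly R[i]} :=
  \poly_(l < 2 ^ m)
    (2 ^- m * \sum_(0 <= j < 2 ^ m) f (node m r j) / node m r j ^+ l).

Lemma interpolant_poly m r (q : {poly R[i]}) : 0 < r -> (size q <= 2 ^ m)%N ->
  interpolant m r (horner q) = q.
Proof.
move=> r0 qm; apply/polyP => k; rewrite coef_poly; case: ltnP => km.
  by rewrite sum_nodes_coef// mulKf ?expf_neq0.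
by rewrite nth_default// (leq_trans qm).
Qed.

(** The Lagrange basis of the nodes, written as a geometric sum because its
    terms have modulus at most [2 ^- m] on the disc. *)
Definition nodal m r j : {poly R[i]} :=
  \poly_(l < 2 ^ m) (2 ^- m / node m r j ^+ l).

Lemma interpolantE m r f z : (interpolant m r f).[z] =
  \sum_(0 <= j < 2 ^ m) f (node m r j) * (nodal m r j).[z].
Proof.
rewrite horner_poly; under [RHS]eq_bigr do rewrite horner_poly mulr_sumr.
rewrite exchange_big /=; apply: eq_bigr => l _.
by rewrite mulrAC mulr_sumr; apply: eq_bigr => j _; ring.
Qed.

Lemma nodal_le1 m r j z : 0 < r -> normc z <= r ->
  normc (nodal m r j).[z] <= 1.
Proof.
move=> r0 zr; rewrite horner_poly; apply: le_trans (le_normc_sum _ _ _) _.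
apply: le_trans (ler_sum _ (G := fun=> 2 ^- m) _) _ => [l _|]; last first.
  by rewrite sumr_const card_ord -[leLHS]mulr_natl natrX mulfV// expf_neq0.
rewrite !normcM !normcV !normcX (normc_node _ _ (ltW r0)) normc_natr.
rewrite -mulrA ler_piMr ?invr_ge0 ?exprn_ge0// mulrC -expr_div_n.
by rewrite exprn_ile1 ?divr_ge0 ?normc_ge0 ?(ltW r0)// ler_pdivrMr// mul1r.
Qed.
End Nodes.

(** * Entire functions of one variable *)

Section Entire.
Context {R : realType}.
Implicit Types (f : R[i] -> R[i]) (m j k : nat) (r : R).

Lemma cdiff_difference_quotient f (z w : R[i]) : cdiff f w -> w != z ->
  cdiff (fun u => (f u - f z) / (u - z)) w.
Proof.
move=> [a fa] wz; set d := w - z; set u := f w - f z.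
have d0 : d != 0 by rewrite subr_eq0.
have nd : 0 < normc d by rewrite normc_gt0.
exists ((a * d - u) / d ^+ 2) => e e0.
set c := normc (a * d - u).
have c0 : 0 <= c := normc_ge0 _.
have c1 : 0 < c + 1 by lra.
have e1 : 0 < e * normc d / 4 by rewrite divr_gt0// mulr_gt0.
have [dl dl0 fdl] := fa _ e1.
have e2 : 0 < e * normc d ^+ 3 / (4 * (c + 1)).
  by rewrite divr_gt0// mulr_gt0// exprn_gt0.
exists (Num.min dl (Num.min (normc d / 2) (e * normc d ^+ 3 / (4 * (c + 1))))).
  by rewrite !lt_min dl0 e2 divr_gt0.
move=> v; rewrite !le_min => /and3P[v1 v2 v3].
set h := v - w in v1 v2 v3 *; set rr := f v - f w - a * h.
have hd : normc d / 2 <= normc (d + h).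
  have := le_normcB d (- h); rewrite normcN opprK; lra.
have dh : 0 < normc (d + h) by lra.
have dh0 : d + h != 0 by rewrite -normc_gt0.
have vz : v - z = d + h by rewrite /d /h; ring.
have -> : (f v - f z) / (v - z) - (f w - f z) / (w - z)
    - (a * d - u) / d ^+ 2 * h
  = rr / (d + h) - (a * d - u) * h ^+ 2 / (d ^+ 2 * (d + h)).
  rewrite vz -/d -/u (_ : f v - f z = u + a * h + rr); last first.
    by rewrite /u /rr; ring.
  by field; rewrite d0 dh0.
apply: le_trans (le_normcD _ _) _.
rewrite normcN 2!normcM (normcM (a * d - u)) !normcV (normcM (d ^+ 2)) !normcX -/c.
have A : normc rr / normc (d + h) <= e / 2 * normc h.
  rewrite ler_pdivrMr//; apply: le_trans (fdl _ v1) _; rewrite -/h.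
  have eh : 0 <= e * normc h by rewrite mulr_ge0 ?normc_ge0// ltW.
  by have := ler_wpM2l eh hd; lra.
have B : c * normc h ^+ 2 / (normc d ^+ 2 * normc (d + h)) <= e / 2 * normc h.
  have h0 := normc_ge0 h.
  rewrite ler_pdivrMr ?mulr_gt0 ?exprn_gt0//.
  have v3' : normc h * (4 * (c + 1)) <= e * normc d ^+ 3.
    by rewrite -ler_pdivlMr// mulr_gt0.
  have B1 : c * normc h <= e * normc d ^+ 3 / 4.
    have : normc h * c <= normc h * (c + 1) by rewrite ler_wpM2l//; lra.
    lra.
  have B2 : e * normc d ^+ 3 / 4 <= e / 2 * (normc d ^+ 2 * normc (d + h)).
    have E0 : 0 <= e * normc d ^+ 2 by rewrite mulr_ge0 ?exprn_ge0// ltW.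
    have -> : e * normc d ^+ 3 / 4 = e * normc d ^+ 2 * (normc d / 4).
      by rewrite exprS; ring.
    have -> : e / 2 * (normc d ^+ 2 * normc (d + h)) =
      e * normc d ^+ 2 * (normc (d + h) / 2) by ring.
    by rewrite ler_wpM2l//; lra.
  have -> : c * normc h ^+ 2 = c * normc h * normc h by ring.
  rewrite [leRHS]mulrAC ler_wpM2r//; lra.
by move: A B; lra.
Qed.

Lemma cdiff_bounded_quotient f (z : R[i]) : cdiff f z ->
  exists2 S : R, 0 < S & exists2 dl : R, 0 < dl & forall w, w != z ->
    normc (w - z) <= dl -> normc ((f w - f z) / (w - z)) <= S.
Proof.
move=> [a /(_ 1 ltr01)[dl dl0 H]].
exists (normc a + 1); first by have := normc_ge0 a; lra.
exists dl => // w wz /H; rewrite mul1r => Hw.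
have d0 : 0 < normc (w - z) by rewrite normc_gt0 subr_eq0.
rewrite normcM normcV ler_pdivrMr// mulrDl mul1r -normcM.
have := le_normcB (f w - f z) (a * (w - z)); lra.
Qed.

Lemma sum_cyclic (K : zmodType) n (F : nat -> K) : F n = F 0%N ->
  \sum_(0 <= j < n) F j.+1 = \sum_(0 <= j < n) F j.
Proof.
move=> Fn; apply/eqP; rewrite -subr_eq0 -sumrB telescope_sumr//.
by rewrite Fn subrr.
Qed.

(** The trapezoidal sum of [F] along a regular polygon is a multiple of the
    mean of [x * F x] over its vertices. *)
Lemma pathsum_polygon (F : R[i] -> R[i]) m r (w := cis (2 ^- m : R)) :
  pathsum F m (fun t => r%:C * cis t) =
  (w - w^-1) / 2 * \sum_(0 <= j < 2 ^ m) F (node m r j) * node m r j.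
Proof.
have w0 : w != 0 by rewrite -normc_eq0 normc_cis oner_neq0.
have nS j : node m r j.+1 = node m r j * w by rewrite !nodeE exprSr mulrA.
have -> : pathsum F m (fun t => r%:C * cis t) =
   (w - 1) / 2 * \sum_(0 <= j < 2 ^ m) F (node m r j) * node m r j +
   (1 - w^-1) / 2 * \sum_(0 <= j < 2 ^ m) F (node m r j.+1) * node m r j.+1.
  rewrite !mulr_sumr -big_split /=; apply: eq_bigr => j _.
  rewrite /chord -/(node m r j) -/(node m r j.+1).
  by rewrite !nS; field.
rewrite (sum_cyclic (F := fun j => F (node m r j) * node m r j)); last first.
  by rewrite !nodeE expr0 (prim_expr_order (cis_primitive m)).
by field.
Qed.

(** Doubling the number of vertices cannot decrease this factor, because
    [v ^+ 2 - v ^- 2 = (v - v^-1) * (v + v^-1)] with a second factor of modulus at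
    most [2]; for the square its modulus is [4]. *)
Lemma polygon_factor_ge m (w := cis (2 ^- m : R)) : (2 <= m)%N ->
  4 <= normc (2 ^+ m * (w - w^-1) / 2).
Proof.
rewrite {}/w; elim: m => // m IH; rewrite leq_eqVlt => /orP[/eqP <-|m2].
  have w2 := @cis_quarter_sqr R.
  have -> : 2 ^+ 2 = 4 :> R by rewrite -natrX.
  set w := cis _ in w2 *.
  have w0 : w != 0 by rewrite -normc_eq0 normc_cis oner_neq0.
  have -> : w^-1 = - w by apply: (mulfI w0); rewrite divff// mulrN -expr2 w2 opprK.
  have -> : 2 ^+ 2 * (w - - w) / 2 = 4 * w by field.
  by rewrite normcM normc_cis normc_natr mulr1.
apply: le_trans (IH m2) _.
set v := cis (2 ^- m.+1).
have v0 : v != 0 by rewrite -normc_eq0 normc_cis oner_neq0.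
have -> : cis (2 ^- m) = v ^+ 2.
  rewrite /v cisX mulr2n; congr cis.
  by rewrite exprS; field; rewrite expf_neq0.
have -> : 2 ^+ m * (v ^+ 2 - v ^- 2) / 2 =
  (2 ^+ m.+1 * (v - v^-1) / 2) * ((v + v^-1) / 2).
  by rewrite (exprS 2 m); field.
rewrite normcM ler_piMr ?normc_ge0// normcM normcV normc_natr.
have := le_normcD v v^-1; rewrite normcV normc_cis invr1; lra.
Qed.

Lemma pathsum_small F m P (eta l : R) : 0 <= l -> lipschitz_path l P ->
  (forall s, 0 <= s <= 1 -> normc (F (P s)) <= eta) ->
  normc (pathsum F m P) <= eta * l.
Proof.
move=> l0 Pl Fe; have := @pathsum_near_affine _ F m P 0 0 eta l l0 Pl.
rewrite !mul0r !addr0 !subr0; apply => s si.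
by rewrite mul0r addr0 subr0; exact: Fe.
Qed.

(** The circle is contracted to [z]: the squares between the circle and its
    image of ratio [s0] contribute little by Goursat's lemma, and the image of
    ratio [s0] contributes [O(s0)] because the difference quotient of [f] at
    [z] is bounded near [z]. *)
Lemma polygon_quotient_to0 f (z : R[i]) r : (forall w, cdiff f w) ->
  normc z < r -> forall e : R, 0 < e -> exists m0, forall m, (m0 <= m)%N ->
  normc (pathsum (fun w => (f w - f z) / (w - z)) m (fun t => r%:C * cis t))
    <= e.
Proof.
move=> df zr e e0; pose F w := (f w - f z) / (w - z).
rewrite -/F.
have r0 : 0 < r := le_lt_trans (normc_ge0 z) zr.
have [S S0 [dl dl0 FS]] := cdiff_bounded_quotient (df z).
have rcis t : normc (r%:C * cis t) = r.
  by rewrite normcM normc_cis normcR mulr1 gtr0_norm.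
have cz t : r%:C * cis t - z != 0.
  by rewrite subr_eq0; apply: contraTneq zr => <-; rewrite rcis ltxx.
have cb t : normc (r%:C * cis t - z) <= 2 * r.
  by apply: le_trans (le_normcD _ _) _; rewrite normcN rcis; lra.
have cl t t' : normc (r%:C * cis t - r%:C * cis t') <= 16 * r * `|t - t'|.
  rewrite -mulrBr normcM normcR gtr0_norm// mulrAC mulrC ler_wpM2r ?(ltW r0)//.
  exact: cis_lipschitz.
(* the three terms ensure that [s0 < 1], that the small circle lies where the
   difference quotient is at most [S], and that its contribution is at most
   [e / 2] *)
pose s0 := Num.min (1 / 2) (Num.min (dl / (2 * r)) (e / (2 * (S * (16 * r))))).
have s00 : 0 < s0 by rewrite !lt_min !divr_gt0// !mulr_gt0.
have : s0 <= s0 by []; rewrite {2}/s0 !le_min => /and3P[s1 s2 s3].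
pose lam s : R := s0 + (1 - s0) * s.
have lam01 s : 0 <= s <= 1 -> 0 < lam s <= 1.
  move=> /andP[a b]; rewrite /lam ltr_pwDl ?mulr_ge0//=; last by lra.
  have : (1 - s0) * s <= (1 - s0) * 1 by rewrite ler_wpM2l//; lra.
  lra.
pose g s t := z + (lam s)%:C * (r%:C * cis t - z).
have gL : lipschitz_square (16 * r) g.
  move=> s s' t t' si s'i ti t'i; rewrite /g.
  have -> : z + (lam s)%:C * (r%:C * cis t - z) -
        (z + (lam s')%:C * (r%:C * cis t' - z)) =
      (lam s - lam s')%:C * (r%:C * cis t - z) +
      (lam s')%:C * (r%:C * cis t - r%:C * cis t') by rewrite rmorphB/=; ring.
  apply: le_trans (le_normcD _ _) _; rewrite 2!normcM !normcR.
  have [p q] := andP (lam01 _ s'i).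
  have A : `|lam s - lam s'| * normc (r%:C * cis t - z) <= 16 * r * `|s - s'|.
    have -> : lam s - lam s' = (1 - s0) * (s - s') by rewrite /lam; ring.
    rewrite normrM [X in _ <= X]mulrC -mulrA mulrCA ler_wpM2l//.
    rewrite ger0_norm; last by lra.
    apply: le_trans (ler_wpM2l _ (cb t)) _; first by lra.
    by have := mulr_gt0 s00 r0; nra.
  have B : `|lam s'| * normc (r%:C * cis t - r%:C * cis t') <= 16 * r * `|t - t'|.
    apply: le_trans (cl t t'); rewrite ger0_norm; last exact: ltW.
    by rewrite ler_piMl ?normc_ge0.
  by rewrite mulrDr lerD.
have gz s t : 0 <= s <= 1 -> g s t != z.
  move=> /lam01/andP[p _]; rewrite -subr_eq0 /g addrC addKr mulf_neq0//.
  by rewrite -normc_eq0 normcR normr_eq0 gt_eqF.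
have e2 : 0 < e / 2 by rewrite divr_gt0.
have L0 : 0 <= 16 * r by rewrite mulr_ge0// ltW.
have dF s t : 0 <= s <= 1 -> 0 <= t <= 1 -> cdiff F (g s t).
  by move=> si _; apply: cdiff_difference_quotient => //; exact: gz.
have [m0 H] := circulation_to0 L0 gL dF e2.
exists m0 => m /H; rewrite /circulation.
have -> : pathsum F m (g^~ 1) = pathsum F m (g^~ 0).
  by apply: eq_pathsum => s; rewrite /g cis0 cis1.
have -> : pathsum F m (g 1) = pathsum F m (fun t => r%:C * cis t).
  have lam1 : lam 1 = 1 by rewrite /lam mulr1 addrC subrK.
  by apply: eq_pathsum => t; rewrite /g lam1 mul1r addrC subrK.
rewrite (addrC (pathsum F m (g^~ 0))) addrK => H1.
have : normc (pathsum F m (g 0)) <= S * (s0 * (16 * r)).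
  apply: pathsum_small.
  - by rewrite mulr_ge0// ltW.
  - move=> t t' _ _; rewrite /g /lam mulr0 addr0.
    have -> : z + s0%:C * (r%:C * cis t - z) - (z + s0%:C * (r%:C * cis t' - z)) =
       s0%:C * (r%:C * cis t - r%:C * cis t') by ring.
    by rewrite normcM normcR gtr0_norm// -mulrA ler_wpM2l// ltW.
  move=> t ti; apply: FS; first by apply: gz; rewrite lexx ler01.
  rewrite /g /lam mulr0 addr0 addrC addKr normcM normcR gtr0_norm//.
  apply: le_trans (ler_wpM2l (ltW s00) (cb t)) _.
  by rewrite -ler_pdivlMr// mulr_gt0.
have : S * (s0 * (16 * r)) <= e / 2.
  have := s3; rewrite ler_pdivlMr ?mulr_gt0//; lra.
have := le_normcD (pathsum F m (fun t => r%:C * cis t) - pathsum F m (g 0))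
                  (pathsum F m (g 0)).
rewrite subrK; lra.
Qed.
(** As the Lagrange basis is given by geometric sums, the error at [z] is the
    mean of [x * (f x - f z) / (x - z)] over the nodes [x], up to the factor
    [1 - (z / r) ^+ (2 ^ m)]; up to another factor, bounded from below, that
    mean is the trapezoidal sum of [polygon_quotient_to0]. *)
Lemma interpolant_cvg f (z : R[i]) r : (forall w, cdiff f w) -> normc z < r ->
  forall e : R, 0 < e -> exists m0, forall m, (m0 <= m)%N ->
  normc ((interpolant m r f).[z] - f z) <= e.
Proof.
move=> df zr e e0.
have r0 : 0 < r := le_lt_trans (normc_ge0 z) zr.
have e2 : 0 < e / 2 by rewrite divr_gt0.
have [m0 H] := polygon_quotient_to0 df zr e2.
exists (maxn m0 2) => m; rewrite geq_max => /andP[/H {}H m2].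
move: H; rewrite pathsum_polygon; set A := \sum_(0 <= j < 2 ^ m) _ => H.
have mA : normc (2 ^- m * A) <= e / 2.
  apply: le_trans H.
  have p0 : (2 ^+ m : R[i]) != 0 by rewrite expf_neq0.
  set w := cis _.
  have -> : (w - w^-1) / 2 * A = 2 ^+ m * (w - w^-1) / 2 * (2 ^- m * A).
    by field; rewrite p0 -normc_eq0 normc_cis oner_neq0.
  rewrite [leRHS]normcM -[leLHS]mul1r ler_wpM2r ?normc_ge0//.
  by apply: le_trans (polygon_factor_ge m2); lra.
have rC : (r%:C : R[i]) != 0 by rewrite -normc_eq0 normcR normr_eq0 gt_eqF.
have nz j : node m r j != 0.
  by rewrite -normc_eq0 (normc_node _ _ (ltW r0)) gt_eqF.
have ndz j : node m r j - z != 0.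
  rewrite subr_eq0; apply: contraTneq zr => <-.
  by rewrite (normc_node _ _ (ltW r0)) ltxx.
have -> : (interpolant m r f).[z] - f z = (1 - (z / r%:C) ^+ (2 ^ m)) * (2 ^- m * A).
  have -> : f z = (interpolant m r (horner (f z)%:P)).[z].
    rewrite interpolant_poly ?hornerC//.
    by rewrite (leq_trans (size_polyC_leq1 _))// expn_gt0.
  rewrite !interpolantE -sumrB !mulr_sumr; apply: eq_bigr => j _.
  rewrite hornerC -mulrBl.
  have -> : (nodal m r j).[z] =
      2 ^- m * \sum_(l < 2 ^ m) (z / node m r j) ^+ l.
    rewrite horner_poly mulr_sumr; apply: eq_bigr => l _.
    by rewrite expr_div_n; ring.
  have := subrX1 (z / node m r j) (2 ^ m).
  have -> : (z / node m r j) ^+ (2 ^ m) = (z / r%:C) ^+ (2 ^ m).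
    rewrite nodeE !expr_div_n exprMn -exprM (mulnC j) exprM.
    by rewrite (prim_expr_order (cis_primitive m)) expr1n mulr1.
  set Y := (z / r%:C) ^+ _; set B := \sum_(l < _) _ => YB.
  have -> : B = (1 - Y) * (node m r j / (node m r j - z)).
    have -> : 1 - Y = - (Y - 1) by rewrite opprB.
    by rewrite YB; field; rewrite nz ndz.
  by field; rewrite ndz expf_neq0.
rewrite normcM; apply: le_trans (_ : 2 * (e / 2) <= _); last by lra.
apply: ler_pM; rewrite ?normc_ge0//.
apply: le_trans (le_normcD _ _) _; rewrite normcN normc1 normcX.
suff : normc (z / r%:C) ^+ (2 ^ m) <= 1 by lra.
rewrite normcM normcV normcR gtr0_norm//.
by rewrite exprn_ile1 ?divr_ge0 ?normc_ge0 ?(ltW r0)// ler_pdivrMr// mul1r ltW.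
Qed.

Lemma interpolant_cvg_nodes f m r : (forall w, cdiff f w) -> 0 < r ->
  forall e : R, 0 < e -> exists m0, forall M, (m0 <= M)%N ->
  forall j, (j < 2 ^ m)%N ->
  normc ((interpolant M (2 * r) f).[node m r j] - f (node m r j)) <= e.
Proof.
move=> df r0 e e0; elim: (2 ^ m)%N => [|n [m1 H1]]; first by exists 0%N.
have nr : normc (node m r n) < 2 * r.
  by rewrite (normc_node _ _ (ltW r0)); lra.
have [m2 H2] := interpolant_cvg df nr e0.
exists (maxn m1 m2) => M; rewrite geq_max => /andP[/H1 {}H1 /H2 {}H2] j.
by rewrite ltnS leq_eqVlt => /orP[/eqP->//|/H1].
Qed.

Lemma sum_geometric n : \sum_(k < n) (2 ^- k : R) <= 2.
Proof.
suff -> : \sum_(k < n) (2 ^- k : R) = 2 - 2 * 2 ^- n.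
  by rewrite gerBl mulr_ge0// invr_ge0 exprn_ge0.
elim: n => [|n IH]; first by rewrite big_ord0 expr0 invr1 mulr1 subrr.
by rewrite big_ord_recr /= IH exprS; field; rewrite expf_neq0.
Qed.

Lemma interpolant_coef_bound f m r (S : R) k : 0 < r ->
  (forall w, normc w = r -> normc (f w) <= S) ->
  normc (interpolant m r f)`_k <= S / r ^+ k.
Proof.
move=> r0 fS.
have S0 : 0 <= S.
  apply: le_trans (normc_ge0 _) (fS (r%:C) _).
  by rewrite normcR gtr0_norm.
rewrite coef_poly; case: ifP => _; last first.
  by rewrite normc0 divr_ge0// exprn_ge0// ltW.
rewrite normcM normcV normcX normc_natr ler_pdivrMl ?exprn_gt0//.
apply: le_trans (le_normc_sum _ _ _) _.
apply: le_trans (ler_sum_nat (F := fun j => _) (G := fun j => S / r ^+ k) _) _.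
  move=> j _; rewrite normcM normcV normcX (normc_node _ _ (ltW r0)).
  by rewrite ler_wpM2r ?invr_ge0 ?exprn_ge0 ?(ltW r0)// fS// normc_node// ltW.
by rewrite sumr_const_nat subn0 -[leLHS]mulr_natl natrX.
Qed.

(** The terms of [p] of degree less than [2 ^ m] are interpolated exactly; the
    others are small on the disc of radius [r], and interpolation multiplies
    their maximum by at most the number of nodes. *)
Lemma interpolant_poly_error m r (p : {poly R[i]}) (S : R) z : 0 < r -> 0 <= S ->
  (forall k, normc p`_k <= S / (2 * r) ^+ k) -> normc z <= r ->
  normc ((interpolant m r (horner p)).[z] - p.[z]) <=
    (2 ^+ m + 1) * (2 * S / 2 ^+ (2 ^ m)).
Proof.
move=> r0 S0 pS zr; set N := (2 ^ m)%N.
set B := 2 * S / 2 ^+ N.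
pose h := take_poly N p; pose t := drop_poly N p * 'X^N.
have ph : p = h + t by rewrite /h /t poly_take_drop.
have tB w : normc w <= r -> normc t.[w] <= B.
  move=> wr; rewrite /t hornerM hornerXn horner_coef mulr_suml.
  apply: le_trans (le_normc_sum _ _ _) _.
  have -> : B = S / 2 ^+ N * 2 by rewrite /B; ring.
  apply: le_trans (ler_wpM2l _ (sum_geometric (size (drop_poly N p)))).
    rewrite mulr_sumr; apply: ler_sum => k _.
    rewrite -mulrA -exprD coef_drop_poly normcM normcX addnC.
    have -> : S / 2 ^+ N * 2 ^- k = S / (2 * r) ^+ (N + k) * r ^+ (N + k).
      rewrite exprMn (exprD 2); field.
      by rewrite !expf_neq0// gt_eqF.
    by apply: ler_pM; rewrite ?normc_ge0 ?exprn_ge0 ?normc_ge0//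
      1?addnC// lerXn2r// nnegrE ?normc_ge0// ltW.
  by rewrite divr_ge0// exprn_ge0.
have hI : interpolant m r (horner h) = h.
  by rewrite interpolant_poly// size_take_poly.
have -> : (interpolant m r (horner p)).[z] - p.[z] =
   \sum_(0 <= j < N) t.[node m r j] * (nodal m r j).[z] - t.[z].
  rewrite {2}ph hornerD -{1}hI !interpolantE opprD addrA -sumrB.
  congr (_ - _); apply: eq_bigr => j _.
  by rewrite {1}ph hornerD -mulrBl addrC addKr.
apply: le_trans (le_normcD _ _) _; rewrite normcN mulrDl mul1r.
apply: lerD (tB _ zr); apply: le_trans (le_normc_sum _ _ _) _.
apply: le_trans (ler_sum_nat (F := fun j => _) (G := fun j => B) _) _.
  move=> j _; rewrite normcM -[leRHS]mulr1; apply: ler_pM; rewrite ?normc_ge0//.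
    by rewrite tB// normc_node// ltW.
  exact: nodal_le1.
by rewrite sumr_const_nat subn0 -[leLHS]mulr_natl natrX.
Qed.

(** The error bound is uniform over all functions bounded by [S] on the circle
    of radius [2 * r]: [f] is the pointwise limit of its interpolants on that
    larger circle, whose coefficients obey Cauchy's estimates, and interpolation
    on the circle of radius [r] is exact on their terms of low degree. *)
Lemma interpolant_error f m r (S : R) z : (forall w, cdiff f w) -> 0 < r ->
  (forall w, normc w = 2 * r -> normc (f w) <= S) -> normc z <= r ->
  normc ((interpolant m r f).[z] - f z) <=
    (2 ^+ m + 1) * (2 * S / 2 ^+ (2 ^ m)).
Proof.
move=> df r0 fS zr; apply/ler_addgt0Pr => e e0.
have r2 : 0 < 2 * r by lra.
have S0 : 0 <= S.
  apply: le_trans (normc_ge0 _) (fS ((2 * r)%:C) _).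
  by rewrite normcR gtr0_norm.
have N0 : (0 : R) < 2 ^+ m + 1 by rewrite ltr_pwDr// exprn_ge0.
have e1 : 0 < e / (2 ^+ m + 1) by rewrite divr_gt0.
have [m1 H1] := interpolant_cvg_nodes m df r0 e1.
have zr2 : normc z < 2 * r by lra.
have [m2 H2] := interpolant_cvg df zr2 e1.
have {}H1 := H1 (maxn m1 m2) (leq_maxl _ _).
have {}H2 := H2 (maxn m1 m2) (leq_maxr _ _).
set p := interpolant (maxn m1 m2) (2 * r) f in H1 H2.
have pS k : normc p`_k <= S / (2 * r) ^+ k by exact: interpolant_coef_bound.
have H := interpolant_poly_error m r0 S0 pS zr.
clearbody p.
have -> : (interpolant m r f).[z] - f z =
  ((interpolant m r (horner p)).[z] - p.[z]) +
  ((p.[z] - f z) - \sum_(0 <= j < 2 ^ m)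
      (p.[node m r j] - f (node m r j)) * (nodal m r j).[z]).
  have -> : \sum_(0 <= j < 2 ^ m) (p.[node m r j] - f (node m r j)) * (nodal m r j).[z]
      = (interpolant m r (horner p)).[z] - (interpolant m r f).[z].
    rewrite (interpolantE m r (horner p)) (interpolantE m r f) -sumrB.
    by apply: eq_bigr => j _; rewrite mulrBl.
  move: (interpolant m r (horner p)).[z] (interpolant m r f).[z] => u v.
  by move: p.[z] (f z) => u' v'; ring.
apply: le_trans (le_normcD _ _) _; apply: lerD H _.
apply: le_trans (le_normcD _ _) _; rewrite normcN.
have -> : e = e / (2 ^+ m + 1) + 2 ^+ m * (e / (2 ^+ m + 1)).
  by field; rewrite gt_eqF.
apply: lerD H2 _; apply: le_trans (le_normc_sum _ _ _) _.
apply: le_trans (ler_sum_nat (F := fun j => _) (G := fun j => e / (2 ^+ m + 1)) _) _.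
  move=> j /= jm; rewrite normcM -[leRHS]mulr1; apply: ler_pM; rewrite ?normc_ge0//.
    exact: H1.
  exact: nodal_le1.
by rewrite sumr_const_nat subn0 -[leLHS]mulr_natl natrX.
Qed.

End Entire.

(** * Polynomial functions of several variables *)

Section Polyfun.
Context {R : realType} {n : nat}.
Implicit Types (p q : mpoly n R[i]) (z v : 'cV[R[i]]_n).

(** Proving a closure property this way avoids any handling of monomials. *)
Lemma polyfun_ind (Q : ('cV[R[i]]_n -> R[i]) -> Prop) :
  (forall c, Q (fun=> c)) -> (forall i, Q (fun z => z i ord0)) ->
  (forall F G, Q F -> Q G -> Q (fun z => F z + G z)) ->
  (forall F G, Q F -> Q G -> Q (fun z => F z * G z)) ->
  forall p, Q (polyfun p).
Proof.
move=> QC QX QD QM p.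
have -> : polyfun p = fun z : 'cV[R[i]]_n =>
  \sum_(m <- msupp p) mcoeff m p * \prod_i z i ord0 ^+ m i.
  by apply/funext => z; rewrite /polyfun mevalE.
elim: {1}(msupp p : seq _) => [|m s IH].
  by under eq_fun do rewrite big_nil.
under eq_fun do rewrite big_cons.
apply: (QD _ _ _ IH); apply: (QM) => // {IH}.
elim: (index_enum _) => [|i t IH]; first by under eq_fun do rewrite big_nil.
under eq_fun do rewrite big_cons.
apply: (QM _ _ _ IH) => {IH}; elim: (m i) => [|k IH].
  by under eq_fun do rewrite expr0.
by under eq_fun do rewrite exprS; apply: (QM).
Qed.

Lemma polyfunC c z : polyfun (mpolyC n c) z = c.
Proof. exact: mevalC. Qed.

Lemma polyfunX i z : polyfun (mpolyX R[i] (mnm1 i)) z = z i ord0.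
Proof. exact: mevalXU. Qed.

Lemma polyfunD p q z : polyfun (p + q) z = polyfun p z + polyfun q z.
Proof. exact: mevalD. Qed.

Lemma polyfunB p q z : polyfun (p - q) z = polyfun p z - polyfun q z.
Proof. exact: mevalB. Qed.

Lemma polyfunM p q z : polyfun (p * q) z = polyfun p z * polyfun q z.
Proof. exact: mevalM. Qed.

Lemma polyfun_sum (I : Type) (s : seq I) (P : pred I) (F : I -> mpoly n R[i]) z :
  polyfun (\sum_(i <- s | P i) F i) z = \sum_(i <- s | P i) polyfun (F i) z.
Proof. exact: (big_morph _ (mevalD _) (meval0 _)). Qed.

Lemma polyfun_prod (I : Type) (s : seq I) (P : pred I) (F : I -> mpoly n R[i]) z :
  polyfun (\prod_(i <- s | P i) F i) z = \prod_(i <- s | P i) polyfun (F i) z.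
Proof. exact: (big_morph _ (mevalM _) (meval1 _)). Qed.

Definition polydisc (r : R) z := forall i, normc (z i ord0) <= r.

Lemma polyfun_bounded p (r : R) :
  exists2 C : R, 0 <= C & forall z, polydisc r z -> normc (polyfun p z) <= C.
Proof.
move: p; apply: (polyfun_ind (Q := fun F =>
  exists2 C : R, 0 <= C & forall z, polydisc r z -> normc (F z) <= C))
  => [c|i|F G [C C0 FC] [D D0 GD]|F G [C C0 FC] [D D0 GD]].
- by exists (normc c); rewrite ?normc_ge0.
- by exists (Num.max r 0) => [|z /(_ i) zr]; rewrite le_max ?lexx ?orbT// zr.
- exists (C + D) => [|z zr]; first exact: addr_ge0.
  by apply: le_trans (le_normcD _ _) _; apply: lerD; [exact: FC|exact: GD].
- exists (C * D) => [|z zr]; first exact: mulr_ge0.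
  by rewrite normcM ler_pM ?normc_ge0 ?FC ?GD.
Qed.

(** The bound [m] on the degree is uniform in the line, as [malgrange] needs. *)
Lemma polyfun_line p : exists m, forall z v, exists2 q : {poly R[i]},
  (size q <= m.+1)%N & forall t, polyfun p (z + t *: v) = q.[t].
Proof.
move: p; apply: (polyfun_ind (Q := fun F =>
  exists m, forall z v, exists2 q : {poly R[i]},
  (size q <= m.+1)%N & forall t, F (z + t *: v) = q.[t]))
  => [c|i|F G [k Fk] [l Gl]|F G [k Fk] [l Gl]].
- exists 0%N => z v; exists c%:P; rewrite ?size_polyC_leq1// => t.
  by rewrite hornerC.
- exists 1%N => z v; exists ((z i ord0)%:P + v i ord0 *: 'X).
    rewrite (leq_trans (size_polyD _ _))// geq_max.
    rewrite (leq_trans (size_polyC_leq1 _))//.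
    by rewrite (leq_trans (size_scale_leq _ _))// size_polyX.
  by move=> t; rewrite hornerD hornerZ hornerC hornerX !mxE mulrC.
- exists (maxn k l) => z v; have [f fk fE] := Fk z v; have [g gl gE] := Gl z v.
  exists (f + g) => [|t]; last by rewrite hornerD fE gE.
  by rewrite (leq_trans (size_polyD _ _))// -maxnSS geq_max !leq_max fk gl orbT.
- exists (k + l)%N => z v; have [f fk fE] := Fk z v; have [g gl gE] := Gl z v.
  exists (f * g) => [|t]; last by rewrite hornerM fE gE.
  by rewrite (leq_trans (size_polyMleq _ _))//; lia.
Qed.

Lemma polyfun_taylor p z : exists l : 'I_n -> R[i], forall v,
  exists q : {poly R[i]}, forall t, polyfun p (z + t *: v) =
    polyfun p z + t * \sum_i l i * v i ord0 + t ^+ 2 * q.[t].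
Proof.
move: p; apply: (polyfun_ind (Q := fun F => exists l : 'I_n -> R[i], forall v,
  exists q : {poly R[i]}, forall t, F (z + t *: v) =
    F z + t * \sum_i l i * v i ord0 + t ^+ 2 * q.[t]))
  => [c|i|F G [k Fk] [l Gl]|F G [k Fk] [l Gl]].
- exists (fun=> 0) => v; exists 0 => t.
  by rewrite horner0 big1 => [|i _]; rewrite ?mul0r// !mulr0 !addr0.
- exists (fun j => (j == i)%:R) => v; exists 0 => t.
  rewrite horner0 mulr0 addr0 (bigD1 i)//= eqxx mul1r big1 ?addr0 ?mxE//.
  by move=> j /negbTE->; rewrite mul0r.
- exists (fun i => k i + l i) => v.
  have [f fE] := Fk v; have [g gE] := Gl v; exists (f + g) => t.
  rewrite fE gE hornerD; under [in RHS]eq_bigr do rewrite mulrDl.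
  by rewrite big_split /=; ring.
- exists (fun i => F z * l i + G z * k i) => v.
  have [f fE] := Fk v; have [g gE] := Gl v.
  set a := \sum_i k i * v i ord0 in fE.
  set b := \sum_i l i * v i ord0 in gE.
  exists ((a * b)%:P + (F z) *: g + (G z) *: f + 'X * (a *: g + b *: f)
          + 'X^2 * f * g) => t.
  rewrite fE gE.
  have -> : \sum_i (F z * l i + G z * k i) * v i ord0 = F z * b + G z * a.
    rewrite !mulr_sumr -big_split /=; apply: eq_bigr => i _; ring.
  rewrite !(hornerD, hornerM, hornerZ, hornerC, hornerX, hornerXn).
  ring.
Qed.

End Polyfun.

(** * Division by a polynomial is continuous *)

Section Malgrange.
Context {R : realType}.

Lemma normcJ_real (x : R[i]) : normc (x^*)%C = normc x.
Proof. by case: x => a b /=; rewrite sqrrN. Qed.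

(** Replacing each factor [t - a], [|a| <= 1], by [1 - conj a * t] does not
    change the modulus on the unit circle.  At [0] the new factors have modulus
    [max 1 |a|], and [|1 - a| <= 2 * max 1 |a|]. *)
Lemma reflect_roots (q : {poly R[i]}) m : (size q <= m.+1)%N ->
  exists q' : {poly R[i]},
    (forall t, normc t = 1 -> normc q'.[t] = normc q.[t]) /\
    normc q.[1] <= 2 ^+ m * normc q'.[0].
Proof.
have [q0|q0] := eqVneq q 0.
  move=> _; exists 0; split=> [t _|]; first by rewrite q0.
  by rewrite q0 !horner0 normc0 mulr0.
have [s qE] := closed_field_poly_normal q.
have : lead_coef q != 0 by rewrite lead_coef_eq0.
move: (lead_coef q) qE => c -> c0 {q q0}.
rewrite size_scale// size_prod_XsubC ltnS => sm.
pose u (a : R[i]) : {poly R[i]} :=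
  if normc a <= 1 then 1 - (a^*)%C *: 'X else 'X - a%:P.
exists (c *: \prod_(a <- s) u a); split=> [t t1|].
  rewrite !hornerZ !normcM !horner_prod !normc_prod; congr (_ * _).
  apply: eq_bigr => a _; rewrite /u; case: ifP => // _.
  rewrite !hornerE -normcJ_real rmorphB rmorphM rmorph1 /= conjcK.
  have tt : t * (t^*)%C = 1 by rewrite -sqr_normc normCE t1 -rmorphXn expr1n.
  have -> : t - a = t * (1 - a * (t^*)%C) by rewrite mulrBr mulr1 mulrCA tt mulr1.
  by rewrite normcM t1 mul1r.
rewrite !hornerZ !normcM !horner_prod !normc_prod mulrCA ler_wpM2l ?normc_ge0//.
apply: le_trans (_ : 2 ^+ size s * \prod_(a <- s) normc (u a).[0] <= _); last first.
  rewrite ler_wpM2r ?prodr_ge0// => [a _|]; first exact: normc_ge0.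
  by rewrite ler_weXn2l//; lra.
elim: s {sm} => [|a s IH]; first by rewrite !big_nil expr0 mulr1.
rewrite !big_cons /= exprS mulrACA; apply: ler_pM; rewrite ?normc_ge0//.
  by rewrite prodr_ge0// => b _; exact: normc_ge0.
apply: le_trans (_ : 1 + normc a <= _).
  by rewrite !hornerE; apply: le_trans (le_normcD _ _) _; rewrite normc1 normcN.
rewrite /u; case: (leP (normc a) 1) => a1; rewrite !hornerE ?mulr0 ?subr0.
  by rewrite normc1; lra.
by rewrite ?sub0r normcN; lra.
Qed.

(** Once the roots are reflected, the value at [0] is a mean over the unit
    circle. *)
Lemma malgrange_poly (q h : {poly R[i]}) m (S : R) : (size q <= m.+1)%N ->
  (forall t, normc t = 1 -> normc (q.[t] * h.[t]) <= S) ->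
  normc q.[1] * normc h.[0] <= 2 ^+ m * S.
Proof.
move=> qm qhS; have [q' [q'q q'0]] := reflect_roots qm.
apply: le_trans (ler_wpM2r (normc_ge0 _) q'0) _.
rewrite -mulrA -normcM ler_wpM2l ?exprn_ge0//.
rewrite -hornerM horner_coef0 -[S]divr1 -(expr0 1).
apply: coef_bound => // t t1.
by rewrite hornerM normcM q'q// -normcM qhS.
Qed.

(** The inequality that makes division by [D] continuous: on the complex line
    through [z] and a point [z0] where [D] does not vanish, the one-variable
    estimate applies with a constant that does not depend on [z]. *)
Lemma malgrange n (D : mpoly n R[i]) (z0 : 'cV[R[i]]_n) : polyfun D z0 != 0 ->
  exists2 C : R, 0 <= C & forall (h : mpoly n R[i]) z (S : R),
    (forall t, normc t = 1 ->
       normc (polyfun D (z + t *: (z0 - z)) * polyfun h (z + t *: (z0 - z))) <= S) ->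
    normc (polyfun h z) <= C * S.
Proof.
move=> D0; have [m Dm] := polyfun_line D.
have Dp : 0 < normc (polyfun D z0) by rewrite normc_gt0.
exists (2 ^+ m / normc (polyfun D z0)); first by rewrite divr_ge0 ?exprn_ge0// ltW.
move=> h z S DhS; have [q qm qE] := Dm z (z0 - z).
have [k hk] := polyfun_line h; have [g _ gE] := hk z (z0 - z).
have -> : polyfun h z = g.[0] by rewrite -gE scale0r addr0.
have Dq : polyfun D z0 = q.[1] by rewrite -qE scale1r addrC subrK.
rewrite mulrAC ler_pdivlMr// mulrC Dq.
apply: malgrange_poly => // t t1.
by rewrite -qE -gE DhS.
Qed.
End Malgrange.

(** * Complex differentiability and real estimates *)

Section Differentiability.
Context {R : realType} {n : nat}.
Local Notation CV := ('cV[R[i]]_n : normedModType R[i]).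
Implicit Types (f : 'cV[R[i]]_n -> R[i]) (z h v : 'cV[R[i]]_n).

Lemma gt0_complexE (e : R[i]) : 0 < e -> exists2 r : R, 0 < r & e = r%:C.
Proof.
case: e => a b; rewrite ltcE /= => /andP[/eqP -> a0]; by exists a.
Qed.

(** The topology of the space of columns in terms of real radii. *)
Lemma nbhs_polydisc z (A : set 'cV[R[i]]_n) :
  nbhs (z : CV) A <-> exists2 r : R, 0 < r & forall h, polydisc r h -> A (z + h).
Proof.
split=> [/nbhs_ballP[e /gt0_complexE[r r0 ->] zA]|[r r0 zA]].
  exists (r / 2); first by rewrite divr_gt0.
  move=> h hr; apply: zA; split=> [|i j]; first by rewrite ltcR.
  rewrite -ball_normE /ball_ /= !mxE opprD addrA subrr add0r normrN.
  rewrite (ord1 j) normCE ltcR; apply: le_lt_trans (hr i) _; lra.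
apply/nbhs_ballP; exists (r%:C) => /=; first by rewrite ltcR.
move=> y [_ zy]; rewrite -(subrK z y) addrC; apply: zA => i.
have := zy i ord0; rewrite -ball_normE /ball_ /= normCE ltcR => /ltW.
by rewrite !mxE normcBC.
Qed.

Lemma mx_norm_polydisc h : exists2 r : R, 0 <= r &
  [/\ `|h| = r%:C, polydisc r h & forall s, 0 <= s -> polydisc s h -> r <= s].
Proof.
have : (0 : R[i]) <= `|h| by rewrite normr_ge0.
case E : `|h| => [a b]; rewrite lecE /= => /andP[/eqP b0 a0].
rewrite {}b0 in E *; exists a => //; split=> // [i|s s0 hs]; last first.
  have [/eqP|/mx_norm_neq0[[i j] /=]] := eqVneq (mx_norm h) 0.
    by rewrite -[mx_norm h]/(`|h|) E eq_complex /= => /andP[/eqP->].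
  rewrite -[mx_norm h]/(`|h|) E (ord1 j) normCE => -[->]; exact: hs.
rewrite -lecR -normCE -[a%:C]/(a +i* 0) -E.
have -> : `|h| = mx_norm h by [].
rewrite mx_normE -[leLHS]nngE num_le.
exact: (le_bigmax _ (fun ij : 'I_n * 'I_1 => `|h ij.1 ij.2|%:nng) (i, ord0)).
Qed.

Lemma polydisc_scale (r : R) (t : R[i]) h :
  polydisc r h -> polydisc (normc t * r) (t *: h).
Proof. by move=> hr i; rewrite mxE normcM ler_wpM2l ?normc_ge0. Qed.

Lemma cvg_complexP f z : {for z, continuous (f : CV -> R[i]^o)} ->
  forall e : R, 0 < e -> exists2 r : R, 0 < r &
    forall h, polydisc r h -> normc (f (z + h) - f z) <= e.
Proof.
move=> /cvgrPdist_le fz e e0; have eC : (0 : R[i]) < e%:C by rewrite ltcR.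
have /nbhs_polydisc[r r0 H] := fz _ eC.
by exists r => // h /H; rewrite /= normCE lecR normcBC.
Qed.

Lemma holomorphic_line f z v t : holomorphic f ->
  cdiff (fun t => f (z + t *: v)) t.
Proof.
move=> fh; have /diff_locallyP[_ /eqaddoP fd] := fh (z + t *: v).
move: fd; set D := ('d _ _ : {linear _ -> _}) => fd; exists (D v) => e e0.
have [r r0 [vr pv _]] := mx_norm_polydisc v.
have r1 : 0 < r + 1 by lra.
have eC : (0 : R[i]) < (e / (r + 1))%:C by rewrite ltcR divr_gt0.
have /nbhs_polydisc[d d0 H] := fd _ eC.
exists (d / (r + 1)) => [|w wt]; first by rewrite divr_gt0.
have hv : polydisc d ((w - t) *: v).
  move=> i; apply: le_trans (polydisc_scale (w - t) pv i) _.
  rewrite ler_pdivlMr// in wt; apply: le_trans wt; rewrite ler_wpM2l ?normc_ge0//.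
  lra.
have := H _ hv; rewrite add0r /= /cst /= normrZ vr.
rewrite !fctE linearZ /= (_ : (w - t) *: v + (z + t *: v) = z + w *: v); last first.
  by rewrite scalerBl addrCA subrK.
rewrite -[(w - t) *: _]/((w - t) * D v) [(w - t) * _]mulrC.
rewrite !normCE -!rmorphM lecR opprD addrA => K.
apply: le_trans K _.
rewrite (_ : e / (r + 1) * _ = e * normc (w - t) * (r / (r + 1))); last by ring.
apply: ler_piMr; first by rewrite mulr_ge0 ?normc_ge0// ltW.
by rewrite ler_pdivrMr// mul1r; lra.
Qed.

Definition linear_form (l : 'I_n -> R[i]) h : R[i]^o := \sum_i l i * h i ord0.

Lemma linear_form_is_linear l : linear (linear_form l).
Proof.
move=> a u v; rewrite /linear_form scaler_sumr -big_split /=.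
by apply: eq_bigr => i _; rewrite !mxE mulrDr mulrCA.
Qed.

HB.instance Definition _ l := GRing.isLinear.Build R[i] _ _ _ (linear_form l)
  (linear_form_is_linear l).

Lemma continuous_linear_form l : continuous (linear_form l : CV -> R[i]^o).
Proof.
move=> z; have zF : Filter (nbhs (z : CV)) by exact: nbhs_filter.
apply/cvgrPdist_le => e /gt0_complexE[r r0 ->].
pose L : R := \sum_i normc (l i).
have L0 : 0 <= L by apply: sumr_ge0 => i _; exact: normc_ge0.
have L1 : 0 < L + 1 by lra.
apply/nbhs_polydisc; exists (r / (L + 1)); first by rewrite divr_gt0.
move=> h hr; rewrite raddfD /= opprD addrA subrr add0r normrN normCE lecR.
apply: le_trans (le_normc_sum _ _ _) _.
apply: le_trans (_ : L * (r / (L + 1)) <= _).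
  rewrite mulr_suml; apply: ler_sum => i _; rewrite normcM.
  by rewrite ler_wpM2l ?normc_ge0.
rewrite mulrCA ler_piMr ?(ltW r0)// ler_pdivrMr// mul1r; lra.
Qed.

Lemma differentiable_of_estimate f z (l : 'I_n -> R[i]) :
  (forall e : R, 0 < e -> exists2 r : R, 0 < r & forall h (s : R),
     0 <= s -> s <= r -> polydisc s h ->
     normc (f (z + h) - f z - \sum_i l i * h i ord0) <= e * s) ->
  differentiable (f : 'cV[R[i]]_n -> R[i]^o) (z : CV).
Proof.
move=> H; pose g : CV -> R[i]^o := f.
have E : g \o shift (z : CV) = cst (g z) + linear_form l +o_ 0 id.
  apply/eqaddoP => _ /posnumP[e].
  have [r r0 eE] := gt0_complexE (gt0 e).
  have [d d0 Hd] := H r r0.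
  apply/nbhs_polydisc; exists d => // h hd; rewrite add0r.
  have [s s0 [sE hs smin]] := mx_norm_polydisc h.
  rewrite eE /= sE -rmorphM normCE lecR !fctE /= opprD addrA.
  rewrite (addrC h z); apply: Hd => //; exact: smin (ltW d0) hd.
have D := diff_unique (@continuous_linear_form l) E.
apply/diff_locallyP; rewrite D; split; first exact: continuous_linear_form.
exact: E.
Qed.
End Differentiability.

(** * Polynomial approximation in several variables *)

Section Approximation.
Context {R : realType} {n : nat}.
Local Notation CV := ('cV[R[i]]_n : normedModType R[i]).
Implicit Types (f : 'cV[R[i]]_n -> R[i]) (z h v : 'cV[R[i]]_n).

Lemma holomorphic_cts f z : holomorphic f -> forall e : R, 0 < e ->
  exists2 r : R, 0 < r &
    forall h, polydisc r h -> normc (f (z + h) - f z) <= e.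
Proof.
move=> fh; apply: cvg_complexP.
exact: (differentiable_continuous (fh z)).
Qed.

(** By compactness of a real cube whose image contains the polydisc. *)
Lemma holomorphic_bounded f (r : R) : holomorphic f ->
  exists2 S : R, 0 <= S & forall z, polydisc r z -> normc (f z) <= S.
Proof.
move=> fh.
pose phi (w : 'rV[R]_(n + n)) : 'cV[R[i]]_n :=
  \col_i (w ord0 (lshift n i) +i* w ord0 (rshift n i)).
pose G (w : 'rV[R]_(n + n)) : R := normc (f (phi w)).
have Gc : continuous G.
  move=> w.
  have wF : Filter (nbhs (w : ('rV[R]_(n + n) : normedModType R))).
    by exact: nbhs_filter.
  apply/cvgrPdist_le => e e0.
  have [d d0 fd] := holomorphic_cts (phi w) fh e0.
  apply/(@nbhs_ballP _ ('rV[R]_(n + n) : normedModType R)).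
  exists (d / 2) => /=; first by rewrite divr_gt0.
  move=> w' [_ ww'].
  have : normc (f (phi w') - f (phi w)) <= e.
    rewrite -[phi w'](subrK (phi w)) [_ - _ + _]addrC; apply: fd => i.
    rewrite !mxE; apply: le_trans (normc_le_ReIm _) _ => /=.
    have := ww' ord0 (lshift n i); have := ww' ord0 (rshift n i).
    rewrite -!ball_normE /ball_ /= => A B.
    rewrite -[leLHS]/(`|_ - _| + `|_ - _|) ![`|w' _ _ - _|]distrC; lra.
  have := le_normcB (f (phi w')) (f (phi w)).
  have := le_normcB (f (phi w)) (f (phi w')); rewrite (normcBC (f (phi w))).
  by rewrite ler_norml /G; lra.
have Kc : compact [set w : 'rV[R]_(n + n) | forall i, `[- r, r]%classic (w ord0 i)].
  apply: (@rV_compact _ _ (fun=> `[- r, r]%classic)) => _.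
  exact: segment_compact.
have /compact_bounded[M [_ MG]] := continuous_compact (continuous_subspaceT Gc) Kc.
exists (`|M| + 1); first by rewrite addr_ge0.
move=> z zr; pose w : 'rV[R]_(n + n) :=
  row_mx (\row_i complex.Re (z i ord0)) (\row_i complex.Im (z i ord0)).
have zw : z = phi w.
  apply/colP => i; rewrite mxE row_mxEl row_mxEr !mxE.
  by case: (z i ord0).
rewrite zw; apply: le_trans (ler_norm _) _.
apply: MG; first by rewrite (le_lt_trans (ler_norm M))// ltrDl.
exists w => // i /=; rewrite in_itv /= -ler_norml.
rewrite -(splitK i); case: (fintype.split i) => j /=.
  by rewrite row_mxEl mxE (le_trans (Re_le_normc _)).
by rewrite row_mxEr mxE (le_trans (Im_le_normc _)).
Qed.

Lemma interpolation_rate (S e : R) : 0 <= S -> 0 < e ->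
  exists m, (2 ^+ m + 1) * (2 * S / 2 ^+ (2 ^ m)) <= e.
Proof.
move=> S0 e0; have [k kP] := pow2_large (2 * S / e).
pose m := maxn 3 k; exists m.
have m3 : (2 * m + 1 <= 2 ^ m)%N.
  have : (3 <= m)%N by rewrite leq_maxl.
  elim: m {kP} => // m IH; rewrite leq_eqVlt => /orP[/eqP<-//|m3].
  by have := IH m3; rewrite expnS; lia.
have p0 i : (0 : R) < 2 ^+ i by rewrite exprn_gt0.
have mk : (2 ^+ k : R) <= 2 ^+ m by rewrite ler_weXn2l ?leq_maxr//; lra.
have A : (2 ^+ m * 2 ^+ m * 2 : R) <= 2 ^+ (2 ^ m).
  apply: le_trans (_ : 2 ^+ (2 * m + 1) <= _); last by rewrite ler_weXn2l//; lra.
  by rewrite exprD mul2n -addnn exprD.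
have m1 : (1 : R) <= 2 ^+ m by rewrite exprn_ege1//; lra.
rewrite mulrA ler_pdivrMr//.
have B : 2 * S <= 2 ^+ m * e.
  by rewrite -ler_pdivrMr//; apply: le_trans kP mk.
apply: le_trans (_ : (2 ^+ m + 2 ^+ m) * (2 ^+ m * e) <= _).
  by apply: ler_pM; rewrite ?lerD2l ?mulr_ge0 ?addr_ge0 ?(ltW (p0 _)).
have := ler_wpM2l (ltW e0) A; lra.
Qed.

Lemma polyfun_coord (q : {poly R[i]}) (j : 'I_n) :
  exists p, forall z, polyfun p z = q.[z j ord0].
Proof.
exists (\sum_(k < size q) mpolyC n q`_k * \prod_(l < k) mpolyX R[i] (mnm1 j)).
move=> z; rewrite horner_coef polyfun_sum; apply: eq_bigr => k _.
by rewrite polyfunM polyfunC polyfun_prod polyfunX prodr_const card_ord.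
Qed.

(** The two consequences of holomorphy on which approximation rests; unlike
    differentiability they pass trivially to the restriction of a function to
    a hyperplane where one coordinate is fixed. *)
Definition line_holomorphic f :=
  (forall z v t, cdiff (fun t => f (z + t *: v)) t) /\
  (forall r : R, exists2 S : R, 0 <= S & forall z, polydisc r z -> normc (f z) <= S).

Definition slot (j : 'I_n) (c : R[i]) z : 'cV[R[i]]_n :=
  \col_i (if i == j then c else z i ord0).

Lemma line_holomorphic_slot f j c : line_holomorphic f ->
  line_holomorphic (f \o slot j c).
Proof.
move=> [fl fb]; split=> [z v t|r].
  rewrite (_ : (fun t => _) = (fun t => f (slot j c z + t *: slot j 0 v))).
    exact: fl.
  apply/funext => u /=; congr f; apply/colP => i; rewrite !mxE.
  by case: eqP; rewrite ?mulr0 ?addr0.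
have [S S0 fS] := fb (Num.max r (normc c)).
exists S => // z zr; apply: fS => i; rewrite mxE; case: eqP => _.
  by rewrite le_max lexx orbT.
by rewrite le_max zr.
Qed.

(** Interpolation in the coordinate [k] replaces [f] by a finite sum of products
    of a polynomial in this coordinate and a function of the previous ones. *)
Lemma polynomial_approximation_upto f k : line_holomorphic f -> (k <= n)%N ->
  (forall z z', (forall i : 'I_n, (i < k)%N -> z i ord0 = z' i ord0) -> f z = f z') ->
  forall r e : R, 0 < r -> 0 < e ->
  exists p, forall z, polydisc r z -> normc (f z - polyfun p z) <= e.
Proof.
elim: k f => [|k IH] f fh kn fk r e r0 e0.
  exists (mpolyC n (f 0)) => z _; rewrite polyfunC (fk z 0)// subrr normc0.
  exact: ltW.
pose j := Ordinal kn.
have [fl fb] := fh; have [S S0 fS] := fb (2 * r).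
have e2 : 0 < e / 2 by rewrite divr_gt0.
have [m mP] := interpolation_rate S0 e2.
have p0 : (0 : R) < 2 ^+ m by rewrite exprn_gt0.
have e3 : 0 < e / 2 / 2 ^+ m by rewrite divr_gt0.
(* there are [2 ^ m] nodes, and each Lagrange polynomial is at most [1] *)
have step (a : nat) : exists p : mpoly n R[i], forall z, polydisc r z ->
    normc (f (slot j (node m r a) z) - polyfun p z) <= e / 2 / 2 ^+ m.
  apply: (IH (f \o slot j (node m r a))) => //.
  - exact: line_holomorphic_slot.
  - exact: ltnW.
  - move=> z z' zz' /=; apply: fk => i; rewrite ltnS leq_eqVlt !mxE.
    have [/eqP ij|ij] := eqVneq i j; first by [].
    have /negbTE-> : (i != k :> nat) by apply: contra ij.
    exact: zz'.
have [P PP] := choice step.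
have [Q QP] := choice (fun a => polyfun_coord (nodal m r a) j).
exists (\sum_(0 <= a < 2 ^ m) P a * Q a) => z zr.
have fz : f z = f (slot j (z j ord0) z).
  by congr f; apply/colP => i; rewrite mxE; case: eqP => // ->.
have : normc ((interpolant m r (fun u => f (slot j u z))).[z j ord0] - f z) <= e / 2.
  apply: le_trans mP; rewrite fz.
  apply: (interpolant_error (f := fun u => f (slot j u z))) => //.
    move=> w; rewrite (_ : (fun u => _) =
        fun u => f (slot j 0 z + u *: delta_mx j ord0)).
      exact: fl.
    apply/funext => u; congr f; apply/colP => i; rewrite !mxE eqxx andbT.
    by case: eqP; rewrite ?mulr1 ?mulr0 ?add0r ?addr0.
  move=> w w2; apply: fS => i; rewrite mxE; case: eqP => _; first by rewrite w2.
  by apply: le_trans (zr i) _; lra.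
rewrite interpolantE polyfun_sum.
set A := \sum_(0 <= a < 2 ^ m) f _ * _; set B := \sum_(0 <= a < 2 ^ m) _.
move=> AH.
have AB : normc (A - B) <= e / 2.
  rewrite /A /B -sumrB; apply: le_trans (le_normc_sum _ _ _) _.
  apply: le_trans (ler_sum_nat (F := fun j => _) (G := fun j => e / 2 / 2 ^+ m) _) _.
    move=> a _; rewrite polyfunM QP -mulrBl normcM -[leRHS]mulr1.
    by apply: ler_pM; rewrite ?normc_ge0 ?PP ?nodal_le1.
  by rewrite sumr_const_nat subn0 -[leLHS]mulr_natl natrX mulrC divfK// gt_eqF.
rewrite normcBC in AH.
by have := le_normcD (f z - A) (A - B); rewrite addrA subrK; lra.
Qed.

Lemma polynomial_approximation f (r e : R) : holomorphic f -> 0 < r -> 0 < e ->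
  exists p, forall z, polydisc r z -> normc (f z - polyfun p z) <= e.
Proof.
move=> fh r0 e0; apply: (polynomial_approximation_upto (k := n)) => //.
  by split=> [z v t|s]; [exact: holomorphic_line|exact: holomorphic_bounded].
by move=> z z' zz'; congr f; apply/colP => i; rewrite zz'.
Qed.
End Approximation.

(** * Locally uniform limits of polynomials *)

Section Limits.
Context {R : realType}.

Definition ccvg (u : nat -> R[i]) (a : R[i]) := forall e : R, 0 < e ->
  exists K, forall k, (K <= k)%N -> normc (u k - a) <= e.

Lemma ccvg_ge (u : nat -> R[i]) a b (B : R) :
  ccvg u a -> (exists K, forall k, (K <= k)%N -> normc (b - u k) <= B) ->
  normc (b - a) <= B.
Proof.
move=> ua [K uB]; apply/ler_addgt0Pr => e /ua[K' uK'].
have := uB (maxn K K') (leq_maxl _ _); have := uK' (maxn K K') (leq_maxr _ _).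
by have := le_normcD (b - u (maxn K K')) (u (maxn K K') - a); rewrite addrA subrK; lra.
Qed.

Lemma ccvg_opp (u : nat -> R[i]) a : ccvg u a -> ccvg (fun k => - u k) (- a).
Proof.
by move=> ua e /ua[K uK]; exists K => k /uK; rewrite -opprD normcN.
Qed.

Lemma ccvgD (u v : nat -> R[i]) a b :
  ccvg u a -> ccvg v b -> ccvg (fun k => u k + v k) (a + b).
Proof.
move=> ua vb e e0; have e2 : 0 < e / 2 by rewrite divr_gt0.
have [[K uK] [L vL]] := (ua _ e2, vb _ e2).
exists (maxn K L) => k; rewrite geq_max => /andP[/uK A /vL B].
rewrite opprD addrACA; have := le_normcD (u k - a) (v k - b); lra.
Qed.

Lemma ccvgMl (u : nat -> R[i]) a c : ccvg u a -> ccvg (fun k => c * u k) (c * a).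
Proof.
move=> ua e e0; have c1 : 0 < normc c + 1 by have := normc_ge0 c; lra.
have [K uK] := ua (e / (normc c + 1)) (divr_gt0 e0 c1).
exists K => k /uK; rewrite -mulrBr normcM ler_pdivlMr//.
by have := normc_ge0 (u k - a); lra.
Qed.

Lemma ccvgMr (u : nat -> R[i]) a c : ccvg u a -> ccvg (fun k => u k * c) (a * c).
Proof. by under eq_fun do rewrite mulrC; rewrite mulrC; exact: ccvgMl. Qed.

Lemma ccvg_bounded (u : nat -> R[i]) a (B : R) : ccvg u a ->
  (exists K, forall k, (K <= k)%N -> normc (u k) <= B) -> normc a <= B.
Proof.
move=> ua [K uB]; rewrite -normcN -sub0r; apply: (ccvg_ge ua).
by exists K => k /uB; rewrite sub0r normcN.
Qed.

Lemma ccvg_cst (a : R[i]) : ccvg (fun=> a) a.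
Proof. by move=> e e0; exists 0%N => k _; rewrite subrr normc0 ltW. Qed.

Lemma ccvg_sum (I : Type) (s : seq I) (u : I -> nat -> R[i]) (a : I -> R[i]) :
  (forall i, ccvg (u i) (a i)) ->
  ccvg (fun k => \sum_(i <- s) u i k) (\sum_(i <- s) a i).
Proof.
move=> ua; elim: s => [|i s IH].
  by under eq_fun do rewrite big_nil; rewrite big_nil; exact: ccvg_cst.
by under eq_fun do rewrite big_cons; rewrite big_cons; exact: ccvgD.
Qed.

Lemma ccvg_uniq (u : nat -> R[i]) a b : ccvg u a -> ccvg u b -> a = b.
Proof.
move=> ua ub; apply/eqP; rewrite -subr_eq0 -normc_eq0 eq_le normc_ge0 andbT.
apply/ler_addgt0Pr => e /ua[K uK]; rewrite add0r.
by apply: (ccvg_ge ub); exists K => k /uK; rewrite normcBC.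
Qed.

Lemma cauchy_ccvg (u : nat -> R[i]) :
  (forall e : R, 0 < e -> exists K, forall k l, (K <= k)%N -> (K <= l)%N ->
    normc (u k - u l) <= e) -> exists a, ccvg u a.
Proof.
move=> uC.
have real (x : nat -> R) : (forall k l, `|x k - x l| <= normc (u k - u l)) ->
    exists a : R, forall e : R, 0 < e ->
      exists K, forall k, (K <= k)%N -> `|x k - a| <= e.
  move=> xu; have : cvg (x @ \oo).
    apply/cauchy_cvgP/cauchy_exP => e e0.
    have [|K uK] := uC (e / 2); first by rewrite divr_gt0.
    exists (x K); exists K => // k /= Kk; rewrite -ball_normE /ball_ /=.
    by apply: le_lt_trans (le_trans (xu _ _) (uK _ _ _ _)) _ => //; lra.
  move=> /cvg_ex[a /cvgrPdist_le xa]; exists a => e /xa[K _ Ka].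
  by exists K => k Kk; rewrite distrC; exact: Ka.
have [|a aP] := real (fun k => complex.Re (u k)).
  by move=> k l; rewrite -(raddfB (@complex.Re R : Rcomplex R -> R)) Re_le_normc.
have [|b bP] := real (fun k => complex.Im (u k)).
  by move=> k l; rewrite -(raddfB (@complex.Im R : Rcomplex R -> R)) Im_le_normc.
exists (a +i* b) => e e0; have e2 : 0 < e / 2 by rewrite divr_gt0.
have [[K Ka] [L Lb]] := (aP _ e2, bP _ e2).
exists (maxn K L) => k; rewrite geq_max => /andP[/Ka + /Lb].
have := normc_le_ReIm (u k - (a +i* b)).
case: (u k) => x y /=; lra.
Qed.

(** Stated along lines, with a polynomial remainder, so that Cauchy's estimates
    apply to its coefficients. *)
Definition taylor_at n (F : 'cV[R[i]]_n -> R[i]) z (l : 'I_n -> R[i]) :=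
  forall v, exists q : {poly R[i]}, forall t, F (z + t *: v) =
    F z + t * \sum_i l i * v i ord0 + t ^+ 2 * q.[t].

Lemma taylor_atB n (F G : 'cV[R[i]]_n -> R[i]) z k l :
  taylor_at F z k -> taylor_at G z l ->
  taylor_at (fun w => F w - G w) z (fun i => k i - l i).
Proof.
move=> Fk Gl v; have [[p pF] [q qG]] := (Fk v, Gl v).
exists (p - q) => t; rewrite pF qG hornerD hornerN.
by under [in RHS]eq_bigr do rewrite mulrBl; rewrite sumrB; ring.
Qed.

Section Cauchy.
Context {n : nat}.
Variables (F : 'cV[R[i]]_n -> R[i]) (z : 'cV[R[i]]_n) (l : 'I_n -> R[i]) (S : R).
Hypothesis Fl : taylor_at F z l.
Hypothesis FS : forall h, polydisc 1 h -> normc (F (z + h)) <= S.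

(** The restriction of [F] to a line through [z] is a polynomial, whose
    coefficients obey Cauchy's estimates. *)
Lemma taylor_line v : polydisc 1 v -> exists q : {poly R[i]},
  [/\ forall k, normc q`_k <= S, forall t, F (z + t *: v) = q.[t],
      q`_0 = F z & q`_1 = \sum_i l i * v i ord0].
Proof.
move=> v1; have [q qE] := Fl v; set a := \sum_i _ in qE *.
pose Q := (F z)%:P + a *: 'X + 'X^2 * q.
have QE t : F (z + t *: v) = Q.[t].
  by rewrite qE !(hornerD, hornerM, hornerZ, hornerC, hornerX, hornerXn); ring.
exists Q; split=> // [k| |].
- rewrite -[S]divr1 -(expr1n R k); apply: coef_bound => // t t1.
  rewrite -QE; apply: FS => i; apply: le_trans (polydisc_scale t v1 i) _.
  by rewrite t1 mul1r.
- by rewrite -horner_coef0 -QE scale0r addr0.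
- by rewrite !coefD coefC coefZ coefX coefXnM /= mulr1 add0r addr0.
Qed.

Lemma taylor_coef_bound i : normc (l i) <= S.
Proof.
have [|q [qS _ _ q1]] := @taylor_line (delta_mx i ord0).
  move=> j; rewrite mxE eqxx andbT; case: eqP => _; rewrite ?normc0 ?normc1//.
have := qS 1%N; rewrite q1 (bigD1 i)//= big1 => [|j /negbTE ji].
  by rewrite mxE !eqxx mulr1 addr0.
by rewrite mxE ji mulr0.
Qed.

Lemma taylor_remainder_bound h (s : R) : 0 <= s -> s <= 1 / 2 -> polydisc s h ->
  normc (F (z + h) - F z - \sum_i l i * h i ord0) <= 2 * S * s ^+ 2.
Proof.
move=> s0 s2 hs; have S0 : 0 <= S.
  apply: le_trans (normc_ge0 (F (z + 0))) (FS _) => i.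
  by rewrite mxE normc0.
have [s00|sn0] := eqVneq s 0.
  have -> : h = 0.
    apply/colP => i; rewrite mxE; apply/eqP; rewrite -normc_eq0 eq_le normc_ge0.
    by rewrite andbT -s00 hs.
  rewrite addr0 subrr big1 => [|i _]; last by rewrite mxE mulr0.
  by rewrite subr0 normc0 !mulr_ge0 ?exprn_ge0.
have sC : (s%:C : R[i]) != 0 by rewrite -normc_eq0 normcR normr_eq0.
have sp : 0 < s by rewrite lt_def sn0.
pose v := (s%:C)^-1 *: h.
have hv : h = s%:C *: v by rewrite /v scalerA divff// scale1r.
have v1 : polydisc 1 v.
  move=> i; apply: le_trans (polydisc_scale _ hs i) _.
  by rewrite normcV normcR gtr0_norm// mulVf.
have [q [qS qE q0 q1]] := taylor_line v1.
have -> : \sum_i l i * h i ord0 = s%:C * q`_1.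
  rewrite q1 mulr_sumr; apply: eq_bigr => i _; rewrite hv !mxE; ring.
rewrite hv qE -q0.
have -> : q.[s%:C] - q`_0 - s%:C * q`_1 = s%:C ^+ 2 * (drop_poly 2 q).[s%:C].
  rewrite -{1}(poly_take_drop 2 q) hornerD hornerM hornerXn.
  rewrite (horner_coef_wide _ (size_take_poly 2 q)) !big_ord_recr big_ord0 /=.
  rewrite !coef_take_poly /= expr0 expr1; ring.
rewrite normcM normcX normcR gtr0_norm// mulrC ler_wpM2r ?exprn_ge0//.
rewrite horner_coef; apply: le_trans (le_normc_sum _ _ _) _.
rewrite [leRHS]mulrC.
apply: le_trans (ler_wpM2l S0 (sum_geometric (size (drop_poly 2 q)))).
rewrite mulr_sumr; apply: ler_sum => k _; rewrite normcM coef_drop_poly.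
apply: ler_pM; rewrite ?normc_ge0// normcX normcR gtr0_norm//.
by rewrite -exprVn lerXn2r ?nnegrE ?invr_ge0//; lra.
Qed.

End Cauchy.

Definition locally_uniform_cvg n (P : nat -> 'cV[R[i]]_n -> R[i]) g :=
  forall r e : R, 0 < e -> exists K, forall k, (K <= k)%N ->
    forall z, polydisc r z -> normc (g z - P k z) <= e.

(** Cauchy's estimates make the differentials of the [P k] a Cauchy sequence
    and the remainders of their expansions uniformly quadratic; both pass to the
    limit. *)
Lemma holomorphic_limit n (P : nat -> mpoly n R[i]) (g : 'cV[R[i]]_n -> R[i]) :
  locally_uniform_cvg (fun k => polyfun (P k)) g -> holomorphic g.
Proof.
move=> Pg z; have [r r0 [_ zr _]] := mx_norm_polydisc z.
have [l lP] := choice (fun k => polyfun_taylor (P k) z).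
have near h : polydisc 1 h -> polydisc (r + 1) (z + h).
  move=> h1 i; rewrite mxE; apply: le_trans (le_normcD _ _) _.
  exact: lerD.
have PC (e : R) : 0 < e -> exists K, forall k j, (K <= k)%N -> (K <= j)%N ->
    forall h, polydisc 1 h ->
    normc (polyfun (P k) (z + h) - polyfun (P j) (z + h)) <= e.
  move=> e0; have e2 : 0 < e / 2 by rewrite divr_gt0.
  have [K KP] := Pg (r + 1) _ e2; exists K => k j Kk Kj h /near hr.
  have := KP k Kk _ hr; have := KP j Kj _ hr.
  set a := polyfun _ _; set b := polyfun _ _; set c := g _ => A B.
  have := le_normcD (b - c) (c - a); rewrite addrA subrK (normcBC b); lra.
have Lex i : exists a, ccvg (fun k => l k i) a.
  apply: cauchy_ccvg => e /PC[K KP].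
  exists K => k j Kk Kj.
  exact: (taylor_coef_bound (taylor_atB (lP k) (lP j)) (KP k j Kk Kj) i).
have [L LP] := choice Lex.
have [K KP] := PC 1 ltr01.
have [S S0 SP] := polyfun_bounded (P K) (r + 1).
have PS k : (K <= k)%N -> forall h, polydisc 1 h ->
    normc (polyfun (P k) (z + h)) <= S + 1.
  move=> Kk h h1; have := KP k K Kk (leqnn _) h h1; have := SP _ (near _ h1).
  have := le_normcD (polyfun (P k) (z + h) - polyfun (P K) (z + h))
    (polyfun (P K) (z + h)); rewrite subrK; lra.
have gcvg w : ccvg (fun k => polyfun (P k) w) (g w).
  have [s s0 [_ ws _]] := mx_norm_polydisc w.
  move=> e /(Pg s)[K' H]; exists K' => k /H/(_ w ws); by rewrite normcBC.
apply: (differentiable_of_estimate (l := L)) => e e0.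
exists (Num.min (1 / 2) (e / (2 * (S + 1)))).
  by rewrite lt_min !divr_gt0// mulr_gt0//; lra.
move=> h s s0; rewrite le_min => /andP[s2 se] hs.
apply: le_trans (_ : 2 * (S + 1) * s ^+ 2 <= _); last first.
  rewrite ler_pdivlMr in se; last by rewrite mulr_gt0//; lra.
  have := ler_wpM2l s0 se; rewrite expr2; lra.
have rem : ccvg (fun k => polyfun (P k) (z + h) + - polyfun (P k) z +
      - (\sum_i l k i * h i ord0)) (g (z + h) + - g z + - (\sum_i L i * h i ord0)).
  apply: ccvgD; last by apply: ccvg_opp; apply: ccvg_sum => i; apply: ccvgMr.
  by apply: ccvgD => //; apply: ccvg_opp.
apply: (ccvg_bounded rem); exists K => k Kk.
exact: (taylor_remainder_bound (lP k) (PS k Kk)).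
Qed.
End Limits.

(** * Generic orbits *)

Section Orbits.
Context {R : realType} {n : nat}.

Lemma poly_non_root (q : {poly R[i]}) (s : nat -> R[i]) :
  q != 0 -> injective s -> exists k, q.[s k] != 0.
Proof.
move=> q0 sinj; apply: contrapT => /forallNP H.
have /(max_poly_roots q0) : all (root q) [seq s k | k <- iota 0 (size q)].
  apply/allP => _ /mapP[k _ ->]; rewrite /root.
  by case: eqP (H k) => // _ [].
by rewrite map_inj_uniq// iota_uniq size_map size_iota ltnn => /(_ isT).
Qed.

Lemma polyfun_comp_linear (p : mpoly n R[i]) (A : 'M[R[i]]_n) :
  exists q : mpoly n R[i], forall z, polyfun q z = polyfun p (A *m z).
Proof.
move: p; apply: (polyfun_ind (Q := fun F =>
  exists q : mpoly n R[i], forall z, polyfun q z = F (A *m z))).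
- by move=> c; exists (mpolyC n c) => z; rewrite polyfunC.
- move=> i; exists (\sum_j mpolyC n (A i j) * mpolyX R[i] (mnm1 j)) => z.
  rewrite polyfun_sum mxE; apply: eq_bigr => j _.
  by rewrite polyfunM polyfunC polyfunX.
- by move=> F G [p pF] [q qG]; exists (p + q) => z; rewrite polyfunD pF qG.
- by move=> F G [p pF] [q qG]; exists (p * q) => z; rewrite polyfunM pF qG.
Qed.

(** A product over the other points, of factors that separate one of them from
    [x i0] by a coordinate. *)
Lemma polyfun_interpolation d (x : 'I_d -> 'cV[R[i]]_n) (i0 : 'I_d) :
  injective x -> exists q, forall i, polyfun q (x i) = (i == i0)%:R.
Proof.
move=> xinj.
have sep i : exists q, i != i0 -> polyfun q (x i) = 0 /\ polyfun q (x i0) = 1.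
  have [->|ii0] := eqVneq i i0; first by exists 0.
  have /colP/eqfunP : x i <> x i0 by move=> /xinj/eqP; rewrite (negbTE ii0).
  rewrite negb_forall => /existsP[c xc].
  exists ((mpolyX R[i] (mnm1 c) - mpolyC n (x i c ord0)) *
          mpolyC n (x i0 c ord0 - x i c ord0)^-1) => _.
  rewrite !polyfunM !polyfunB !polyfunX !polyfunC subrr mul0r divff//.
  by rewrite subr_eq0 eq_sym.
have [q qP] := choice sep.
exists (\prod_(i | i != i0) q i) => i; rewrite polyfun_prod.
have [->|ii0] := eqVneq i i0; first by rewrite big1 // => k /qP[].
by rewrite (bigD1 i)//= (qP i ii0).1 mul0r.
Qed.

(** Two distinct matrices differ on a generic point of the moment curve, since
    the entries of their difference are the coefficients of polynomials in the
    parameter of the curve. *)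
Lemma separating_point d (A : 'I_d -> 'M[R[i]]_n) : injective A ->
  exists z : 'cV[R[i]]_n, injective (fun i => A i *m z).
Proof.
move=> Ainj; pose c (t : R[i]) : 'cV[R[i]]_n := \col_k t ^+ k.
have sep (ik : 'I_d * 'I_d) : exists q : {poly R[i]}, q != 0 /\
    forall t, ik.1 != ik.2 -> A ik.1 *m c t = A ik.2 *m c t -> q.[t] = 0.
  case: ik => i k /=; have [->|ik] := eqVneq i k.
    by exists 1; rewrite oner_neq0.
  have : A i - A k != 0 by rewrite subr_eq0 (inj_eq Ainj).
  move=> /matrix0Pn[r [s rs]].
  exists (\sum_l (A i - A k) r l *: 'X^l); split.
    apply: contra_neq rs => /polyP/(_ s).
    rewrite coef0 coef_sum (bigD1 s)//= big1 => [|l /negbTE ls].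
      by rewrite coefZ coefXn eqxx mulr1 addr0.
    by rewrite coefZ coefXn val_eqE eq_sym ls mulr0.
  move=> t _ /eqP; rewrite -subr_eq0 -mulmxBl => /eqP/colP/(_ r).
  rewrite !mxE horner_sum => {2}<-; apply: eq_bigr => l _.
  by rewrite hornerZ hornerXn !mxE.
have [q qP] := choice sep.
have Q0 : \prod_ik q ik != 0 by apply/prodf_neq0 => ik _; exact: (qP ik).1.
have natrI : injective (fun k : nat => k%:R : R[i]).
  by move=> k l /eqP; rewrite eqr_nat => /eqP.
have [k qk] := poly_non_root Q0 natrI.
exists (c k%:R) => i j /= ij; apply/eqP; apply: contraT => nij.
move: qk; rewrite horner_prod (bigD1 (i, j))//=.
by rewrite ((qP (i, j)).2 k%:R nij ij) mul0r eqxx.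
Qed.

End Orbits.

(** * Bases over the invariants *)

Section Basis.
Context {R : realType} {n d : nat}.
Variables (G : set 'M[R[i]]_n) (p : 'I_d -> mpoly n R[i]) (s : 'I_d -> 'M[R[i]]_n).
Hypothesis Gs : forall i, G (s i).
Hypothesis s_inj : injective s.
Hypothesis p_span : forall q : mpoly n R[i], exists2 a : 'I_d -> mpoly n R[i],
  forall i, invariant_poly G (a i) & q = \sum_(i < d) p i * a i.

Let orb i (z : 'cV[R[i]]_n) := invmx (s i) *m z.

(** The system of linear equations with unknowns [g j z], obtained by moving
    the equation [f = \sum_j p j * g j] along the orbit of [z]. *)
Let M z : 'M[R[i]]_d := \matrix_(i, j) polyfun (p j) (orb i z).

(** At a point [z0] with [d] distinct images, a relation [u] between the rows
    annihilates the values on the orbit of every polynomial, hence also those of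
    one that vanishes on the orbit except at a single point. *)
Lemma system_det_neq0 : exists z0, \det (M z0) != 0.
Proof.
have inv_inj : injective (fun i => invmx (s i)).
  by move=> i j /(congr1 (@invmx _ _)); rewrite !invmxK => /s_inj.
have [z0 z0inj] := separating_point inv_inj.
exists z0; apply/det0P => -[u u0 uM].
have [/negP[]|] := boolP [forall i, u ord0 i == 0]; last first.
  rewrite negb_forall => /existsP[i0 ui0].
  have [q qP] := polyfun_interpolation i0 z0inj.
  have [a aG qE] := p_span q.
  have : \sum_i u ord0 i * polyfun q (orb i z0) = u ord0 i0.
    rewrite (bigD1 i0)//= big1 => [|i /negbTE ii0].
      by rewrite qP eqxx mulr1 addr0.
    by rewrite qP ii0 mulr0.
  have -> : \sum_i u ord0 i * polyfun q (orb i z0) =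
      \sum_i \sum_j u ord0 i * polyfun (p j * a j) (orb i z0).
    by apply: eq_bigr => i _; rewrite qE polyfun_sum mulr_sumr.
  rewrite exchange_big big1 /= => [u00|j _]; first by rewrite -u00 eqxx in ui0.
  have uMj : (u *m M z0) ord0 j = 0 by rewrite uM mxE.
  transitivity ((u *m M z0) ord0 j * polyfun (a j) z0); last by rewrite uMj mul0r.
  rewrite mxE mulr_suml; apply: eq_bigr => i _.
  by rewrite polyfunM mxE /orb (aG j (s i) z0 (Gs i)) mulrA.
move=> /forallP uz; move/eqP: u0; apply.
by apply/rowP => i; rewrite mxE; apply/eqP.
Qed.

Lemma system_solve (b : 'I_d -> 'cV[R[i]]_n -> R[i]) :
  (forall j, invariant_fun G (b j)) -> forall z j,
  \det (M z) * b j z =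
    \sum_i \adj (M z) j i * \sum_k polyfun (p k) (orb i z) * b k (orb i z).
Proof.
move=> bG z j; pose B : 'cV[R[i]]_d := \col_k b k z.
have : (\adj (M z) *m M z *m B) j ord0 = \det (M z) * b j z.
  by rewrite mul_adj_mx mul_scalar_mx !mxE.
rewrite -mulmxA mxE => <-; apply: eq_bigr => i _; congr (_ * _).
by rewrite mxE; apply: eq_bigr => k _; rewrite !mxE (bG k _ _ (Gs i)).
Qed.

Lemma system_poly : exists D : 'M[mpoly n R[i]]_d, forall z,
  \det (M z) = polyfun (\det D) z /\
  forall j i, \adj (M z) j i = polyfun (\adj D j i) z.
Proof.
have H (ij : 'I_d * 'I_d) := polyfun_comp_linear (p ij.2) (invmx (s ij.1)).
have [q qP] := choice H.
exists (\matrix_(i, j) q (i, j)) => z; rewrite /polyfun.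
set D := (\matrix_(i, j) q (i, j) : 'M[mpoly n R[i]]_d).
have -> : M z = map_mx (meval (fun i => z i ord0)) D.
  by apply/matrixP => i j; rewrite !mxE -[RHS]/(polyfun _ _) qP.
by rewrite det_map_mx; split=> // j i; rewrite -map_mx_adj mxE.
Qed.

Lemma orbit_bounded : exists2 B : R, 0 <= B &
  forall i z (r : R), 0 <= r -> polydisc r z -> polydisc (B * r) (orb i z).
Proof.
exists (\sum_i \sum_a \sum_b normc (invmx (s i) a b)).
  by do 3!(apply: sumr_ge0 => ? _); exact: normc_ge0.
move=> i z r r0 zr a; rewrite mxE; apply: le_trans (le_normc_sum _ _ _) _.
apply: le_trans (_ : (\sum_b normc (invmx (s i) a b)) * r <= _).
  by rewrite mulr_suml; apply: ler_sum => b _; rewrite normcM ler_wpM2l ?normc_ge0.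
rewrite ler_wpM2r// (bigD1 i)//= [X in _ <= X + _](bigD1 a)//= -addrA lerDl addr_ge0//.
  by do 2!(apply: sumr_ge0 => ? _); exact: normc_ge0.
by do 3!(apply: sumr_ge0 => ? _); exact: normc_ge0.
Qed.

(** Cramer's rule bounds the product of [b j] with the determinant of the
    system, and the determinant is divided out by [malgrange]. *)
Lemma coordinates_bound (r : R) : 0 <= r ->
  exists r' C : R, forall (b : 'I_d -> mpoly n R[i]) (e : R),
    (forall j, invariant_poly G (b j)) ->
    (forall w, polydisc r' w ->
       normc (\sum_k polyfun (p k) w * polyfun (b k) w) <= e) ->
    forall j z, polydisc r z -> normc (polyfun (b j) z) <= C * e.
Proof.
move=> r0; have [D DP] := system_poly.
have [z0] := system_det_neq0; rewrite (DP z0).1 => Dz0.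
have [C C0 CP] := malgrange Dz0.
have [r1 r10 [_ z0r _]] := mx_norm_polydisc z0.
have [B B0 BP] := orbit_bounded.
(* bounds the circle of radius [|z0 - z|] around any [z] of the polydisc *)
pose rho : R := 2 * r + r1.
have rho0 : 0 <= rho by rewrite /rho; lra.
have Hadj (ij : 'I_d * 'I_d) : exists K : R, 0 <= K /\
    forall z, polydisc rho z -> normc (polyfun (\adj D ij.1 ij.2) z) <= K.
  by have [K K0 KP] := polyfun_bounded (\adj D ij.1 ij.2) rho; exists K.
have [K KP] := choice Hadj.
pose T : R := \sum_j \sum_i K (j, i).
exists (B * rho), (C * T) => b e bG be j z zr.
rewrite -mulrA; apply: CP => t t1.
have wr : polydisc rho (z + t *: (z0 - z)).
  move=> i; rewrite !mxE; apply: le_trans (le_normcD _ _) _.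
  rewrite normcM t1 mul1r; have := le_normcD (z0 i ord0) (- z i ord0).
  by rewrite normcN; have := zr i; have := z0r i; rewrite /rho; lra.
move: (_ + _ : 'cV__) wr => w wr.
have := system_solve bG w j; rewrite (DP w).1 => ->.
have e0 : 0 <= e by apply: le_trans (normc_ge0 _) (be _ (BP j _ _ rho0 wr)).
apply: le_trans (le_normc_sum _ _ _) _.
apply: le_trans (_ : \sum_i K (j, i) * e <= _).
  apply: ler_sum => i _; rewrite normcM (DP w).2.
  apply: ler_pM; rewrite ?normc_ge0//; first exact: (KP (j, i)).2.
  exact: be (BP i _ _ rho0 wr).
rewrite -mulr_suml ler_wpM2r// /T [leRHS](bigD1 j)//= lerDl.
by do 2!(apply: sumr_ge0 => ? _); exact: (KP _).1.
Qed.

(** The two families agree where the determinant of the system does not vanish;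
    every [z] is a limit of such points on the line through [z] and [z0]. *)
Lemma coordinates_uniq (g h : 'I_d -> 'cV[R[i]]_n -> R[i]) :
  (forall j, invariant_fun G (g j) /\ holomorphic (g j)) ->
  (forall j, invariant_fun G (h j) /\ holomorphic (h j)) ->
  (forall z, \sum_j polyfun (p j) z * g j z = \sum_j polyfun (p j) z * h j z) ->
  g = h.
Proof.
move=> gP hP gh; have [D DP] := system_poly.
have [z0] := system_det_neq0; rewrite (DP z0).1 => Dz0.
have eqD z j : polyfun (\det D) z != 0 -> g j z = h j z.
  move=> Dz; apply: (mulfI Dz); rewrite -(DP z).1.
  rewrite (system_solve (fun j => (gP j).1)) (system_solve (fun j => (hP j).1)).
  by apply: eq_bigr => i _; rewrite gh.
apply/funext => j; apply/funext => z; apply/eqP; rewrite -subr_eq0 -normc_eq0.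
rewrite eq_le normc_ge0 andbT; apply/ler_addgt0Pr => e e0; rewrite add0r.
have e2 : 0 < e / 2 by rewrite divr_gt0.
have [a a0 ga] := holomorphic_cts z (gP j).2 e2.
have [b b0 hb] := holomorphic_cts z (hP j).2 e2.
have [m Dm] := polyfun_line (\det D); have [q _ qE] := Dm z (z0 - z).
have q0 : q != 0.
  apply: contraNneq Dz0 => q0.
  by rewrite (_ : z0 = z + 1 *: (z0 - z)) ?qE ?q0 ?horner0// scale1r addrC subrK.
have [r r0 [_ vr _]] := mx_norm_polydisc (z0 - z).
pose dl := Num.min a b / (r + 1).
have ab0 : 0 < Num.min a b by rewrite lt_min a0 b0.
have r1 : 0 < r + 1 by lra.
have dl0 : 0 < dl by rewrite divr_gt0.
have dlE : dl * (r + 1) = Num.min a b by rewrite /dl divfK// gt_eqF.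
clearbody dl.
pose t k : R[i] := (dl / k.+1%:R)%:C.
have tinj : injective t.
  have dn0 : dl != 0 by rewrite gt_eqF.
  move=> k l /complexI/(mulfI dn0).
  by move=> /invr_inj/eqP; rewrite eqr_nat eqSS => /eqP.
have [k qk] := poly_non_root q0 tinj.
have hv : polydisc (Num.min a b) (t k *: (z0 - z)).
  move=> i; apply: le_trans (polydisc_scale _ vr i) _.
  rewrite normcR ger0_norm ?divr_ge0 ?(ltW dl0)//.
  rewrite -dlE.
  have dk : dl / k.+1%:R <= dl.
    by rewrite ler_pdivrMr// ler_peMr ?(ltW dl0)// ler1n.
  by apply: ler_pM dk _ => //; rewrite ?divr_ge0 ?(ltW dl0)//; lra.
have A : normc (g j (z + t k *: (z0 - z)) - g j z) <= e / 2.
  by apply: ga => i; apply: le_trans (hv i) _; rewrite ge_min lexx.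
have B : normc (h j (z + t k *: (z0 - z)) - h j z) <= e / 2.
  by apply: hb => i; apply: le_trans (hv i) _; rewrite ge_min lexx orbT.
have := eqD (z + t k *: (z0 - z)) j; rewrite qE => /(_ qk) E.
rewrite E normcBC in A.
by have := le_normcD (g j z - h j (z + t k *: (z0 - z)))
  (h j (z + t k *: (z0 - z)) - h j z); rewrite addrA subrK; lra.
Qed.

(** [f] is a locally uniform limit of polynomials; by [coordinates_bound] their
    coordinates in the basis converge as well. *)
Lemma coordinates_exist (f : 'cV[R[i]]_n -> R[i]) : holomorphic f ->
  exists2 g : 'I_d -> 'cV[R[i]]_n -> R[i],
    forall j, invariant_fun G (g j) /\ holomorphic (g j) &
    forall z, f z = \sum_j polyfun (p j) z * g j z.
Proof.
move=> fh.
have approx k : exists q, forall z, polydisc k.+1%:R z ->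
    normc (f z - polyfun q z) <= (k.+1%:R)^-1.
  by apply: polynomial_approximation; rewrite ?invr_gt0.
have [F FP] := choice approx.
have Hspan k : exists a : 'I_d -> mpoly n R[i],
    (forall i, invariant_poly G (a i)) /\ F k = \sum_(i < d) p i * a i.
  by have [a] := p_span (F k); exists a.
have [a aP] := choice Hspan.
have large (r e : R) : 0 < e -> exists K, forall k, (K <= k)%N ->
    r <= k.+1%:R /\ (k.+1%:R)^-1 <= e :> R.
  have bnd (x : R) k : (Num.bound x <= k)%N -> x <= k.+1%:R.
    move=> xk; have [x0|x0] := leP 0 x; last exact: le_trans (ltW x0) _.
    apply: ltW (lt_le_trans (archi_boundP x0) _).
    by rewrite ler_nat ltnW.
  move=> e0; exists (maxn (Num.bound r) (Num.bound e^-1)) => k.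
  rewrite geq_max => /andP[/bnd rk /bnd ek]; split=> //.
  by rewrite -[e]invrK lef_pV2 ?posrE ?invr_gt0.
have FC (r e : R) : 0 < e -> exists K, forall k, (K <= k)%N ->
    forall z, polydisc r z -> normc (f z - polyfun (F k) z) <= e.
  move=> e0; have [K KP] := large r e e0; exists K => k /KP[rk ek] z zr.
  by apply: le_trans ek; apply: FP => i; apply: le_trans (zr i) rk.
have aC (r e : R) : 0 <= r -> 0 < e -> exists K, forall k l,
    (K <= k)%N -> (K <= l)%N -> forall j z, polydisc r z ->
    normc (polyfun (a k j) z - polyfun (a l j) z) <= e.
  move=> r0 e0; have [r' [C CP]] := coordinates_bound r0.
  pose c := Num.max C 1.
  have c0 : 0 < c by rewrite lt_max ltr01 orbT.
  have e2 : 0 < e / c / 2 by rewrite !divr_gt0.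
  have [K KP] := FC r' _ e2; exists K => k l Kk Kl j z zr.
  have ec : 0 <= e / c by rewrite divr_ge0 ?ltW.
  apply: le_trans (_ : C * (e / c) <= _); last first.
    have : C * (e / c) <= c * (e / c) by rewrite ler_wpM2r// le_max lexx.
    by rewrite [c * _]mulrC divfK// gt_eqF.
  rewrite -polyfunB; apply: (CP (fun j => a k j - a l j)) => //.
    move=> i rho w Grho; rewrite !polyfunB.
    by rewrite ((aP k).1 i _ _ Grho) ((aP l).1 i _ _ Grho).
  move=> w wr.
  have -> : \sum_i polyfun (p i) w * polyfun (a k i - a l i) w =
      (f w - polyfun (F l) w) - (f w - polyfun (F k) w).
    rewrite (aP k).2 (aP l).2 !polyfun_sum.
    under [in LHS]eq_bigr do rewrite polyfunB mulrBr.
    under [X in _ = _ - X - _]eq_bigr do rewrite polyfunM.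
    under [X in _ = _ - (_ - X)]eq_bigr do rewrite polyfunM.
    by rewrite sumrB; ring.
  have := KP k Kk w wr; have := KP l Kl w wr.
  have := le_normcD (f w - polyfun (F l) w) (- (f w - polyfun (F k) w)).
  by rewrite normcN; lra.
have lim j z : exists c, ccvg (fun k => polyfun (a k j) z) c.
  have [r r0 [_ zr _]] := mx_norm_polydisc z.
  apply: cauchy_ccvg => e e0; have [K KP] := aC r e r0 e0.
  by exists K => k l Kk Kl; exact: KP.
have [g gP] := choice (fun jz : 'I_d * 'cV[R[i]]_n => lim jz.1 jz.2).
exists (fun j z => g (j, z)) => [j|z].
  split=> [rho z Grho|].
    apply: (ccvg_uniq (gP (j, _))) => e /(gP (j, z))[K KP].
    by exists K => k /KP; rewrite /= ((aP k).1 j _ _ Grho).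
  apply: (holomorphic_limit (P := fun k => a k j)) => r e e0.
  have r0 : 0 <= Num.max r 0 by rewrite le_max lexx orbT.
  have [K KP] := aC _ _ r0 e0; exists K => k Kk z zr.
  rewrite normcBC; apply: (ccvg_ge (gP (j, z))); exists K => l Kl.
  by apply: KP => // i; rewrite le_max zr.
have fz : ccvg (fun k => polyfun (F k) z) (f z).
  have [r r0 [_ zr _]] := mx_norm_polydisc z.
  by move=> e /(FC r)[K KP]; exists K => k /KP/(_ z zr); rewrite normcBC.
apply: (ccvg_uniq fz).
rewrite (_ : (fun k => _) = fun k => \sum_j polyfun (p j) z * polyfun (a k j) z).
  by apply: ccvg_sum => j; apply: ccvgMl; exact: (gP (j, z)).
apply/funext => k; rewrite (aP k).2 polyfun_sum.
by apply: eq_bigr => j _; rewrite polyfunM.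
Qed.

End Basis.

Lemma enumerate_of_card (T : Type) (A : set T) (d : nat) : (A #= `I_d)%card ->
  exists2 s : 'I_d -> T, (forall i, A (s i)) & injective s.
Proof.
move=> /card_esym/card_bijP[phi /bij_inj phi_inj].
exists (fun i : 'I_d => \val (phi (SigSub (mem_set (ltn_ord i : `I_d i))))) => [i|i j].
  exact: set_valP.
move=> /val_inj/phi_inj/(congr1 val)/= ij.
exact: val_inj.
Qed.

Local Close Scope complex_scope.

Theorem theorem3p2 (R : realType) (n : nat) (G : set 'M[R[i]]_n) (d : nat)
    (G_card : (G #= `I_d)%card)
    (G_gen : generated_by_pseudoreflections G)
    (f : 'cV[R[i]]_n -> R[i]) (f_hol : holomorphic f)
    (p : 'I_d -> mpoly n R[i]) (p_basis : basis_over_invariants G p) :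
  exists! g : 'I_d -> 'cV[R[i]]_n -> R[i],
    (forall i : 'I_d, invariant_fun G (g i) /\ holomorphic (g i)) /\
    (forall z : 'cV[R[i]]_n, f z = \sum_(i < d) polyfun (p i) z * g i z).
Proof.
have [s Gs s_inj] := enumerate_of_card G_card.
have [g gP fg] := coordinates_exist Gs s_inj p_basis.1 f_hol.
exists g; split=> // h [hP fh].
apply: (coordinates_uniq Gs s_inj p_basis.1 gP hP) => z.
by rewrite -fg -fh.
Qed.
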